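(* For $k=4$, the decision problem $\mathrm{StarExp}(k)$ defined in the context is $\mathsf{NP}$-hard.
   Context: A temporal graph is a pair $(G,\tau)$ where $G$ is a finite simple graph and $\tau: E(G)\to 2^{\mathbb{N}}$ assigns to each edge $e$ a finite set $\tau(e)$ of times at which $e$ is active; a pair $(e,t)$ with $t\in\tau(e)$ is a time-edge. A (strict) temporal $(x,y)$-walk is a sequence $(e_1,t_1),\dots,(e_n,t_n)$ of time-edges such that $e_1,\dots,e_n$ is a walk in $G$ from $x$ to $y$ and $t_1<t_2<\dots<t_n$; it is closed if $x=y$. Let $S_n$ denote the star with $n$ leaves. A temporal star $(S_n,\tau)$ is explorable if it admits a closed temporal walk starting (and ending) at the center of the star that visits every leaf. The problem $\mathrm{StarExp}(k)$: given a temporal star $(S_n,\tau)$ with $|\tau(e)|\le k$ for every edge $e$, decide whether $(S_n,\tau)$ is explorable. *)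

(* Defs.v *)
From HB Require Import structures.
From mathcomp Require Import all_boot finmap.

Set Implicit Arguments.
Unset Strict Implicit.
Unset Printing Implicit Defensive.

Inductive move := MoveLeft | Stay | MoveRight.

Definition move_code (m : move) : option bool :=
  match m with MoveLeft => Some false | Stay => None | MoveRight => Some true end.
Definition move_decode (o : option bool) : move :=
  match o with Some false => MoveLeft | None => Stay | Some true => MoveRight end.
Lemma move_codeK : cancel move_code move_decode. Proof. by case. Qed.
HB.instance Definition _ := Finite.copy move (can_type move_codeK).

(* Tape symbols over the binary input alphabet: [None] is the blank,
   [Some (inl b)] is the bit b, [Some (inr a)] is a machine-specific symbol. *)
Definition symbol (aux : finType) : finType := option (bool + aux)%type.

(* A two-way infinite tape, blank outside the recorded part.  [left_of] lists
   the cells to the left of the head, nearest first; [right_of] lists those to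
   its right, nearest first. *)
Record tape (aux : finType) := Tape {
  left_of : seq (symbol aux);
  scanned : symbol aux;
  right_of : seq (symbol aux)
}.

Definition tape_act (aux : finType) (t : tape aux) (a : symbol aux * move) :
    tape aux :=
  match a.2 with
  | MoveLeft =>
      Tape (behead (left_of t)) (head None (left_of t)) (a.1 :: right_of t)
  | Stay => Tape (left_of t) a.1 (right_of t)
  | MoveRight =>
      Tape (a.1 :: left_of t) (head None (right_of t)) (behead (right_of t))
  end.

Definition blank_tape (aux : finType) : tape aux := Tape [::] None [::].

Definition input_tape (aux : finType) (w : seq bool) : tape aux :=
  let s := [seq Some (inl b) | b <- w] in Tape [::] (head None s) (behead s).

Fixpoint bit_prefix (aux : finType) (s : seq (symbol aux)) : seq bool :=
  if s is Some (inl b) :: s' then b :: bit_prefix s' else [::].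

Definition tape_output (aux : finType) (t : tape aux) : seq bool :=
  bit_prefix (scanned t :: right_of t).

(* There are [extra_tapes.+1] tapes; the machine halts when the set of
   available transitions is empty. *)
Record machine := Machine {
  extra_tapes : nat;
  aux_symbol : finType;
  state : finType;
  start : state;
  accepting : pred state;
  delta : state -> {ffun 'I_extra_tapes.+1 -> symbol aux_symbol} ->
          {set state * {ffun 'I_extra_tapes.+1 -> symbol aux_symbol * move}}
}.

Definition deterministic (M : machine) : Prop :=
  forall (q : state M) s, #|delta q s| <= 1.

Record config (M : machine) := Config {
  current : state M;
  tapes : {ffun 'I_(extra_tapes M).+1 -> tape (aux_symbol M)}
}.

Definition init (M : machine) (w : seq bool) : config M :=
  Config (start M)
    [ffun i => if i == ord0 then input_tape (aux_symbol M) w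
               else blank_tape (aux_symbol M)].

Definition options (M : machine) (c : config M) :=
  delta (current c) [ffun i => scanned (tapes c i)].

Definition step (M : machine) (c c' : config M) : Prop :=
  exists2 a, a \in options c &
    c' = Config a.1 [ffun i => tape_act (tapes c i) (a.2 i)].

Definition halted (M : machine) (c : config M) : Prop := options c = set0.

Inductive steps (M : machine) : nat -> config M -> config M -> Prop :=
  | steps0 c : steps 0 c c
  | stepsS n c c' c'' : step c c' -> steps n c' c'' -> steps n.+1 c c''.

(* The output is written on the last tape, from the head rightwards. *)
Definition output (M : machine) (c : config M) : seq bool :=
  tape_output (tapes c ord_max).

Definition language := seq bool -> Prop.

Definition polynomial_time_computable (f : seq bool -> seq bool) : Prop :=
  exists M : machine, deterministic M /\
  exists a d : nat, forall w : seq bool, exists n (c : config M),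
    [/\ n <= a * size w ^ d + a, steps n (init M w) c, halted c & output c = f w].

Definition in_NP (L : language) : Prop :=
  exists (M : machine) (a d : nat), forall w : seq bool,
    (forall n (c : config M), steps n (init M w) c -> n <= a * size w ^ d + a) /\
    (L w <-> exists n (c : config M),
               [/\ steps n (init M w) c, halted c & accepting (current c)]).

Record decision_problem := DecisionProblem {
  instance : Type;
  encoding : instance -> seq bool;
  yes_instance : instance -> Prop
}.

Definition poly_many_one_reducible (L : language) (P : decision_problem) : Prop :=
  exists f : seq bool -> instance P,
    polynomial_time_computable (fun w => encoding (f w)) /\
    forall w, L w <-> yes_instance (f w).

Definition NP_hard (P : decision_problem) : Prop :=
  forall L : language, in_NP L -> poly_many_one_reducible L P.

Record sgraph := SGraph {
  vertex :> finType;
  adj : rel vertex;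
  adj_sym : symmetric adj;
  adj_irrefl : irreflexive adj
}.

Definition is_edge (G : sgraph) (e : {set G}) : bool :=
  [exists x, exists y, adj x y && (e == [set x; y])].

Definition edge (G : sgraph) := {e : {set G} | is_edge e}.

Definition time_labelling (G : sgraph) := edge G -> {fset nat}.

(* [es] is a walk that starts at [x] and then visits the vertices [p] in turn. *)
Fixpoint is_walk (G : sgraph) (x : G) (es : seq (edge G)) (p : seq G) : bool :=
  match es, p with
  | [::], [::] => true
  | e :: es', y :: p' => (val e == [set x; y]) && is_walk y es' p'
  | _, _ => false
  end.

Definition temporal_walk (G : sgraph) (tau : time_labelling G) (x y : G)
    (W : seq (edge G * nat)) (p : seq G) : Prop :=
  [/\ forall e t, (e, t) \in W -> t \in tau e,
      is_walk x (unzip1 W) p,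
      last x p = y
    & sorted ltn (unzip2 W)].

(* The centre of the star is [None]; its leaves are the [Some i]. *)
Definition star_adj (n : nat) : rel (option 'I_n) :=
  fun x y => (x == None) != (y == None).

Lemma star_adj_sym n : symmetric (@star_adj n).
Proof. by move=> x y; rewrite /star_adj eq_sym. Qed.

Lemma star_adj_irrefl n : irreflexive (@star_adj n).
Proof. by move=> x; rewrite /star_adj eqxx. Qed.

Definition star (n : nat) : sgraph :=
  SGraph (@star_adj_sym n) (@star_adj_irrefl n).

Definition center (n : nat) : star n := None.
Definition leaf (n : nat) (i : 'I_n) : star n := Some i.

Lemma star_edge_subproof n (i : 'I_n) :
  is_edge [set center n; leaf i].
Proof. by apply/existsP; exists None; apply/existsP; exists (Some i); rewrite eqxx. Qed.

Definition star_edge (n : nat) (i : 'I_n) : edge (star n) :=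
  Sub [set center n; leaf i] (star_edge_subproof i).

Definition explorable (n : nat) (tau : time_labelling (star n)) : Prop :=
  exists W p, temporal_walk tau (center n) (center n) W p /\
    forall i : 'I_n, leaf i \in center n :: p.

Record temporal_star (k : nat) := TemporalStar {
  leaves : nat;
  times : time_labelling (star leaves);
  times_bound : forall e, #|` times e| <= k
}.

(* Binary expansion, least significant bit first, without leading zeros. *)
Definition binary (t : nat) : seq bool :=
  [seq odd (t %/ 2 ^ j) | j <- iota 0 (up_log 2 t.+1)].

(* Each bit b of a time is written 0b, the end of a time is written 10, and the
   end of the list of times of an edge is written 11. *)
Definition encode_time (t : nat) : seq bool :=
  flatten [seq [:: false; b] | b <- binary t] ++ [:: true; false].

Definition encode_times (A : {fset nat}) : seq bool :=
  flatten [seq encode_time t | t <- sort leq A] ++ [:: true; true].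

Definition encode_star (k : nat) (S : temporal_star k) : seq bool :=
  flatten [seq encode_times (times (star_edge i)) | i <- enum 'I_(leaves S)].

Definition StarExp (k : nat) : decision_problem :=
  @DecisionProblem (temporal_star k) (@encode_star k)
    (fun S => explorable (@times k S)).

(* Main.v *)
(* A leaf of a star is visited during an interval between two of its times, and
   a closed walk is a family of pairwise disjoint intervals, one for each leaf.
   A clause is a leaf with times 0, 2, 5, 8 (shifted), whose three minimal
   intervals stand for its literals; a variable is a leaf with four times, of
   which the first two bound a region of time for one literal and the last two a
   region for the other, the middle being blocked by a leaf with only two times.
   The leaf occupies the region of the false literal.  A wire for each literal
   occurrence is placed either in the region of the literal or inside the
   interval of the clause, so that a clause can be placed iff it has a true
   literal.

   The 3-CNF formula is that of a computation of a nondeterministic machine.  It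
   is the instantiation of finitely many templates at all [t, j < N], where [N]
   exceeds the time bound.  Times are strings of one-hot codes of [t] and [j],
   hence need not be polynomially bounded, and no arithmetic is required to print
   them: the reduction is a doubly nested loop, whose indices are the positions of
   marks on two tapes of length [N]. *)

From HB Require Import structures.
From mathcomp Require Import all_boot finmap zify.
Require Import Defs.

Set Implicit Arguments.
Unset Strict Implicit.
Unset Printing Implicit Defensive.

(** * Structured programs for four-tape machines *)

(** A leaf could also pick an interval that joins two of its gadgets; the leaves with two times
    exclude this. An interval of a wire that runs from its clause to a region contains the forced
    interval [[9, 10]] behind the clause, and an interval of a variable that runs from one region to
    the other contains the forced interval at the end of the first. What remains is a binary choice
    for each variable and each wire. Times are compared through their leading digits, which name the
    variable, then the literal, then the wire. Gadgets are thus apart as soon as their codes differ,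
    in whatever order the codes come. This is what allows one-hot codes, in which adding a constant
    to an index is moving zeros from one side of the code to the other. An assignment is read only
    through the variables that it makes true: a configuration is followed step by step, and the
    variables that describe it are shown to be true. Some transition is true at each time, and the
    clauses on reading force it to fit the configuration reached. *)

(* The auxiliary symbol [None] fills cells; [Some x] marks a cell that holds
   the bit [b] if [x = Some b] and the filler if [x = None]. *)
Definition aux : finType := option (option bool).
Arguments symbol : simpl never.
Notation sym := (symbol aux).
Notation tp := (tape aux).
Definition act := (sym * move)%type.

(** Nested pairs instead of functions on ['I_4], so that projections and updates reduce by
    computation; [tuple_of_quad] makes the conversion once, for [frag_machine]. *)
Definition quad (X : Type) := ((X * X) * (X * X))%type.

Definition scan (T : quad tp) : quad sym :=
  ((scanned T.1.1, scanned T.1.2), (scanned T.2.1, scanned T.2.2)).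
Definition acts (T : quad tp) (a : quad act) : quad tp :=
  ((tape_act T.1.1 a.1.1, tape_act T.1.2 a.1.2),
   (tape_act T.2.1 a.2.1, tape_act T.2.2 a.2.2)).

Definition keep (s : sym) : act := (s, Stay).
Definition keep2 (s : sym * sym) : act * act := (keep s.1, keep s.2).
Definition keep4 (s : quad sym) : quad act := (keep2 s.1, keep2 s.2).

Lemma tape_act_keep (t : tp) : tape_act t (keep (scanned t)) = t.
Proof. by case: t. Qed.

Lemma acts_keep4 T : acts T (keep4 (scan T)) = T.
Proof. by case: T => [[? ?] [? ?]]; rewrite /acts /= !tape_act_keep. Qed.

(* The exit of a fragment is the successor [None]. *)
Record frag := Frag {
  fstate : finType;
  finit : fstate;
  fnext : fstate -> quad sym -> option fstate * quad act
}.

Inductive frun (F : frag) : fstate F -> quad tp -> nat -> quad tp -> Prop :=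
  | frun_exit q T a : fnext q (scan T) = (None, a) -> frun q T 1 (acts T a)
  | frun_next q q' T a n T' : fnext q (scan T) = (Some q', a) ->
      frun q' (acts T a) n T' -> frun q T n.+1 T'.

Definition runs (F : frag) (B : nat) (T T' : quad tp) : Prop :=
  exists2 n, n <= B & frun (finit F) T n T'.

Lemma runs_weaken F B B' T T' : runs F B T T' -> B <= B' -> runs F B' T T'.
Proof. by case=> n le_n r le_B; exists n => //; apply: leq_trans le_B. Qed.

Definition Do (f : quad sym -> quad act) : frag :=
  Frag (fstate := unit) tt (fun _ s => (None, f s)).

Definition Seq (F G : frag) : frag :=
  Frag (fstate := (fstate F + fstate G)%type) (inl (finit F))
    (fun q s => match q with
     | inl q => let: (o, a) := fnext q s in
         (Some (if o is Some q' then inl q' else inr (finit G)), a)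
     | inr q => let: (o, a) := fnext q s in (omap inr o, a)
     end).

Definition While (test : quad sym -> bool) (F : frag) : frag :=
  Frag (fstate := option (fstate F)) None
    (fun q s => if q is Some q then
         let: (o, a) := fnext q s in (Some o, a)
       else (if test s then Some (Some (finit F)) else None, keep4 s)).

Definition When (test : quad sym -> bool) (F : frag) : frag :=
  Frag (fstate := option (fstate F)) None
    (fun q s => if q is Some q then
         let: (o, a) := fnext q s in (omap Some o, a)
       else (if test s then Some (Some (finit F)) else None, keep4 s)).

Lemma runs_Do f T : runs (Do f) 1 T (acts T (f (scan T))).
Proof. by exists 1 => //; apply: frun_exit. Qed.

Lemma runs_Seq F G b1 b2 T T' T'' :
  runs F b1 T T' -> runs G b2 T' T'' -> runs (Seq F G) (b1 + b2) T T''.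
Proof.
move=> [n le_n rF] [m le_m rG]; exists (n + m); first exact: leq_add.
move: rF; rewrite /=; move: (finit F) => q rF.
elim: rF rG => {q T n T' le_n} [q T a E | q q' T a n T' E _ IH] rG.
  apply: (frun_next (q' := inr (finit G) : fstate (Seq F G)) (a := a)).
    by rewrite /= E.
  elim: rG => {T T'' m le_m E} [p T b E | p p' T b m T'' E _ IH].
    by apply: frun_exit; rewrite /= E.
  by apply: frun_next IH; rewrite /= E.
by apply: frun_next (IH rG); rewrite /= E.
Qed.

Lemma runs_While0 (test : quad sym -> bool) F T : ~~ test (scan T) -> runs (While test F) 1 T T.
Proof.
move=> nt; exists 1 => //; rewrite -{2}[T]acts_keep4.
by apply: frun_exit; rewrite /= (negbTE nt).
Qed.

Lemma runs_WhileS (test : quad sym -> bool) F b1 b2 T T' T'' : test (scan T) ->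
  runs F b1 T T' -> runs (While test F) b2 T' T'' ->
  runs (While test F) (b1 + b2).+1 T T''.
Proof.
move=> tT [n le_n rF] [m le_m rG]; exists (n + m).+1; first by rewrite ltnS leq_add.
apply: (frun_next (q' := Some (finit F) : fstate (While test F))
  (a := keep4 (scan T))); first by rewrite /= tT.
rewrite acts_keep4; move: (finit F) rF rG => q rF.
elim: rF => {q T n T' le_n tT} [q T a E | q q' T a n T' E _ IH] rG.
  by apply: frun_next rG; rewrite /= E.
by apply: frun_next (IH rG); rewrite /= E.
Qed.

Lemma runs_When0 (test : quad sym -> bool) F T : ~~ test (scan T) -> runs (When test F) 1 T T.
Proof.
move=> nt; exists 1 => //; rewrite -{2}[T]acts_keep4.
by apply: frun_exit; rewrite /= (negbTE nt).
Qed.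

Lemma runs_When1 (test : quad sym -> bool) F b T T' : test (scan T) ->
  runs F b T T' -> runs (When test F) b.+1 T T'.
Proof.
move=> tT [n le_n rF]; exists n.+1 => //.
apply: (frun_next (q' := Some (finit F) : fstate (When test F))
  (a := keep4 (scan T))); first by rewrite /= tT.
rewrite acts_keep4; move: (finit F) rF => q rF.
elim: rF => {q T n T' le_n tT} [q T a E | q q' T a n T' E _ IH].
  by apply: frun_exit; rewrite /= E.
by apply: frun_next IH; rewrite /= E.
Qed.

(** * Fragments as deterministic machines *)

Definition tuple_of_quad X (T : quad X) : {ffun 'I_4 -> X} :=
  [ffun i : 'I_4 => nth T.1.1 [:: T.1.1; T.1.2; T.2.1; T.2.2] i].
Definition quad_of_tuple X (s : {ffun 'I_4 -> X}) : quad X :=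
  ((s (inord 0), s (inord 1)), (s (inord 2), s (inord 3))).

Lemma tuple_of_quadK X : cancel (@tuple_of_quad X) (@quad_of_tuple X).
Proof.
move=> [[x y] [z u]].
by rewrite /quad_of_tuple !ffunE !inordK.
Qed.

Definition frag_delta (F : frag) (q : option (fstate F))
    (s : {ffun 'I_4 -> sym}) :
    {set option (fstate F) * {ffun 'I_4 -> act}} :=
  if q is Some q' then
    let: (o, a) := fnext q' (quad_of_tuple s) in [set (o, tuple_of_quad a)]
  else set0.

Definition frag_machine (F : frag) : machine :=
  @Machine 3 aux (option (fstate F)) (Some (finit F)) pred0 (@frag_delta F).

Lemma frag_machine_deterministic F : deterministic (frag_machine F).
Proof.
move=> [q|] s /=; last by rewrite cards0.
by case: (fnext _ _) => o a; rewrite cards1.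
Qed.

Definition frag_config (F : frag) (q : option (fstate F)) (T : quad tp) :
    config (frag_machine F) :=
  @Config (frag_machine F) q (tuple_of_quad T).

Lemma frag_config_step F (q : fstate F) T o a :
  fnext q (scan T) = (o, a) ->
  step (frag_config (Some q) T) (frag_config o (acts T a)).
Proof.
move=> E; exists (o, tuple_of_quad a).
  rewrite /options /=.
  have -> : [ffun i => scanned (tuple_of_quad T i)] = tuple_of_quad (scan T).
    by apply/ffunP; case=> -[|[|[|[|]]]] // i; rewrite !ffunE.
  by rewrite tuple_of_quadK E inE.
congr Config; apply/ffunP.
by case=> -[|[|[|[|]]]] // i; rewrite !ffunE.
Qed.

Lemma frag_machine_steps F B T T' : runs F B T T' ->
  exists n, n <= B /\ steps n (frag_config (Some (finit F)) T) (frag_config None T').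
Proof.
move=> [n le_n r]; exists n; split=> //; elim: r => {T T' le_n n}.
  by move=> q T a E; apply: stepsS (steps0 _); apply: frag_config_step.
by move=> q q' T a n T' E _ IH; apply: stepsS IH; apply: frag_config_step.
Qed.

Lemma frag_machine_init F w :
  init (frag_machine F) w =
  frag_config (Some (finit F))
    ((input_tape aux w, blank_tape aux), (blank_tape aux, blank_tape aux)).
Proof.
congr Config; apply/ffunP.
by case=> -[|[|[|[|]]]] // i; rewrite !ffunE.
Qed.

Lemma frag_machine_computes (f : seq bool -> seq bool) (F : frag) (B : nat -> nat) :
  (exists a d, forall n, B n <= a * n ^ d + a) ->
  (forall w, exists2 T, runs F (B (size w))
     ((input_tape aux w, blank_tape aux), (blank_tape aux, blank_tape aux)) T
     & tape_output T.2.2 = f w) ->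
  polynomial_time_computable f.
Proof.
move=> [a [d leB]] spec; exists (frag_machine F); split.
  exact: frag_machine_deterministic.
exists a, d => w; have [T r out] := spec w.
have [n [le_n st]] := frag_machine_steps r.
exists n, (frag_config None T); split => //.
- exact: leq_trans le_n (leB _).
- by rewrite frag_machine_init.
- by rewrite /output -out /= ffunE.
Qed.

(** * Counter tapes and loops *)

(** The Boolean [i] selects one of the first two tapes, so that each program on a counter tape is
    written once for both loop indices. *)
Definition get X (i : bool) (P : X * X) : X := if i then P.2 else P.1.
Definition put X (i : bool) (x : X) (P : X * X) : X * X :=
  if i then (P.1, x) else (x, P.2).

Lemma get_scan i x P (R : tp * tp) : get i (scan (put i x P, R)).1 = scanned x.
Proof. by case: i. Qed.

Definition Mv (i : bool) (f : sym -> act) : frag :=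
  Do (fun s => (put i (f (get i s.1)) (keep2 s.1), keep2 s.2)).

Lemma runs_Mv i f x P R :
  runs (Mv i f) 1 (put i x P, R) (put i (tape_act x (f (scanned x))) P, R).
Proof.
have := runs_Do (fun s => (put i (f (get i s.1)) (keep2 s.1), keep2 s.2))
  (put i x P, R).
by case: i P R => -[? ?] [? ?]; rewrite /acts /= !tape_act_keep.
Qed.

Definition nonblank (s : sym) : bool := s != None.

Definition goL (s : sym) : act := (s, MoveLeft).
Definition goR (s : sym) : act := (s, MoveRight).

Definition bit (b : bool) : sym := Some (inl b).
Definition filler : sym := Some (inr None).

Definition otape (o : seq bool) : tp := Tape (rev (map bit o)) None [::].

Lemma otape_rcons o b : otape (rcons o b) = tape_act (otape o) (bit b, MoveRight).
Proof. by rewrite /otape map_rcons rev_rcons. Qed.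

Definition Emit (g : quad sym -> bool) : frag :=
  Do (fun s => (keep2 s.1, (keep s.2.1, (bit (g s), MoveRight)))).

Lemma runs_Emit g P z o :
  runs (Emit g) 1 (P, (z, otape o))
    (P, (z, otape (rcons o (g (scan (P, (z, otape o))))))).
Proof.
have := runs_Do (fun s => (keep2 s.1, (keep s.2.1, (bit (g s), MoveRight))))
  (P, (z, otape o)).
by case: P => x y; rewrite otape_rcons /acts /= !tape_act_keep.
Qed.

(** The counter tapes come back unchanged, heads included, and the third tape and the earlier output
    are arbitrary: this lets printing fragments be sequenced and used as loop bodies. *)
Definition prints (F : frag) (B : nat) (P : tp * tp) (o : seq bool) : Prop :=
  forall z o0, runs F B (P, (z, otape o0)) (P, (z, otape (o0 ++ o))).

Definition Skip : frag := Do keep4.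

Lemma runs_Skip T : runs Skip 1 T T.
Proof. by rewrite -{2}[T]acts_keep4; apply: runs_Do. Qed.

Definition Block (Fs : seq frag) : frag := foldr Seq Skip Fs.

Lemma prints_Emit b P : prints (Emit (fun=> b)) 1 P [:: b].
Proof. by move=> z o; rewrite cats1; apply: (runs_Emit (fun=> b)). Qed.

Lemma prints_Seq F G b1 b2 P o1 o2 :
  prints F b1 P o1 -> prints G b2 P o2 -> prints (Seq F G) (b1 + b2) P (o1 ++ o2).
Proof. by move=> pF pG z o; rewrite catA; apply: runs_Seq (pF _ _) (pG _ _). Qed.

Lemma prints_Block X (f : X -> frag) (o : X -> seq bool) (c : X -> nat) P s :
  (forall x, prints (f x) (c x) P (o x)) ->
  prints (Block (map f s)) (sumn (map c s)).+1 P (flatten (map o s)).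
Proof.
move=> pf; elim: s => [|x s IH] /=; last by rewrite -addnS; apply: prints_Seq.
by move=> z o0; rewrite cats0; apply: runs_Skip.
Qed.

Definition dbl (s : seq bool) : seq bool := flatten [seq [:: false; b] | b <- s].

Lemma dbl_cat s1 s2 : dbl (s1 ++ s2) = dbl s1 ++ dbl s2.
Proof. by rewrite /dbl map_cat flatten_cat. Qed.

Definition Raw (s : seq bool) : frag := Block [seq Emit (fun=> b) | b <- s].

Lemma prints_Raw s P : prints (Raw s) (size s).+1 P s.
Proof.
have := @prints_Block _ _ (fun b => [:: b]) (fun=> 1) P s (fun b => prints_Emit b P).
by rewrite flatten_seq1 sumnE big_map sum1_size.
Qed.

Definition cell (s : sym) : bool :=
  match s with Some (inl _) | Some (inr None) => true | _ => false end.
Definition mark (s : sym) : sym :=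
  Some (inr (Some (if s is Some (inl b) then Some b else None))).
Definition orig (s : sym) : option bool :=
  if s is Some (inr (Some x)) then x else None.
Definition unmark (s : sym) : sym := if orig s is Some b then bit b else filler.
Definition marked (s : sym) : bool :=
  if s is Some (inr (Some _)) then true else false.

Lemma markK s : cell s -> unmark (mark s) = s.
Proof. by case: s => [[[]|[[[]|]|]]|]. Qed.

Lemma cell_nonblank s : cell s -> nonblank s. Proof. by case: s. Qed.
Lemma cell_unmarked s : cell s -> ~~ marked s.
Proof. by case: s => [[[]|[[[]|]|]]|]. Qed.

(* A counter tape holds a list [C] of cells between two blanks; [cstart], [cend]
   and [cmark] have the head on the first cell, on the blank after the last one,
   and on the cell number [v], which is marked. *)
Definition cur (l C : seq sym) : tp :=
  Tape l (head None (rcons C None)) (behead (rcons C None)).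
Definition cstart (C : seq sym) : tp := cur [:: None] C.
Definition cend (C : seq sym) : tp := Tape (rcons (rev C) None) None [::].
Definition cmark (C : seq sym) (v : nat) : tp :=
  Tape (rcons (rev (take v C)) None) (mark (nth None C v))
    (rcons (drop v.+1 C) None).

Lemma cur_end C : cur (rcons (rev C) None) [::] = cend C. Proof. by []. Qed.

Definition walkL (i : bool) : frag :=
  While (fun s => nonblank (get i s.1)) (Mv i goL).

Lemma runs_walkL i (l : seq sym) x r P R : all nonblank (x :: l) ->
  runs (walkL i) (2 * size l + 3) (put i (Tape (rcons l None) x r) P, R)
    (put i (Tape [::] None (rev l ++ x :: r)) P, R).
Proof.
elim: l x r => [|y l IH] x r /andP[nx nl].
  apply: (@runs_WhileS _ _ 1 1); first by rewrite get_scan.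
    exact: (runs_Mv i goL (Tape [:: None] x r)).
  by apply: runs_While0; rewrite get_scan.
rewrite rev_cons cat_rcons.
have -> : 2 * size (y :: l) + 3 = (1 + (2 * size l + 3)).+1 by rewrite /=; lia.
apply: runs_WhileS (IH y (x :: r) nl); first by rewrite get_scan.
exact: (runs_Mv i goL (Tape (rcons (y :: l) None) x r)).
Qed.

Definition Rewind (i : bool) : frag :=
  Seq (Mv i goL) (Seq (walkL i) (Mv i goR)).

Lemma runs_Rewind i (C : seq sym) P R : all nonblank C ->
  runs (Rewind i) (2 * size C + 5) (put i (cend C) P, R) (put i (cstart C) P, R).
Proof.
move=> nC; have -> : 2 * size C + 5 = 1 + ((2 * size C + 3) + 1) by lia.
apply: runs_Seq (runs_Mv i goL (cend C) P R) _.
apply: runs_Seq (runs_Mv i goR (Tape [::] None (rcons C None)) P R).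
case/lastP: C nC => [|C x] nC.
  apply: (@runs_weaken _ 1); last by [].
  by apply: runs_While0; rewrite get_scan.
rewrite all_rcons in nC; rewrite /tape_act /= rev_rcons /=.
apply: (@runs_weaken _ (2 * size (rev C) + 3)).
  have := @runs_walkL i (rev C) x [:: None] P R.
  by rewrite revK /= all_rev -!cats1 -catA; apply.
by rewrite size_rcons size_rev; set k := size C; lia.
Qed.

(* During the body the current cell is marked, so that the body may move the
   head of the tape as long as it comes back to the mark. *)
Definition For (i : bool) (F : frag) : frag :=
  Seq (While (fun s => nonblank (get i s.1))
        (Seq (Mv i (fun s => (mark s, Stay)))
          (Seq F (Mv i (fun s => (unmark s, MoveRight))))))
      (Rewind i).

(** [R v] is the state of the last two tapes before round [v]; the proof is an induction on the
    number of rounds left. *)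
Lemma runs_For i F (C : seq sym) b P (R : nat -> tp * tp) : all cell C ->
  (forall v, v < size C ->
     runs F b (put i (cmark C v) P, R v) (put i (cmark C v) P, R v.+1)) ->
  runs (For i F) (size C * (b + 5) + 6)
    (put i (cstart C) P, R 0) (put i (cstart C) P, R (size C)).
Proof.
move=> cC rF.
have -> : size C * (b + 5) + 6 = (size C * (b + 3) + 1) + (2 * size C + 5) by lia.
apply: (runs_Seq (T' := (put i (cend C) P, R (size C)))); last first.
  by apply: runs_Rewind; apply: sub_all cC => s; apply: cell_nonblank.
have H : forall k v, v + k = size C ->
  runs (While (fun s => nonblank (get i s.1))
        (Seq (Mv i (fun s => (mark s, Stay)))
          (Seq F (Mv i (fun s => (unmark s, MoveRight))))))
    (k * (b + 3) + 1)
    (put i (cur (rcons (rev (take v C)) None) (drop v C)) P, R v)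
    (put i (cend C) P, R (size C)).
  elim=> [|k IH] v Ev.
    have {Ev} -> : v = size C by lia.
    by rewrite drop_size take_size cur_end; apply: runs_While0; rewrite get_scan.
  have lt_v : v < size C by lia.
  have cv : cell (nth None C v) by apply: (all_nthP None cC).
  have -> : k.+1 * (b + 3) + 1 = ((1 + (b + 1)) + (k * (b + 3) + 1)).+1 by lia.
  apply: runs_WhileS (IH v.+1 _); last by lia.
    by rewrite get_scan (drop_nth None) //= cell_nonblank.
  apply: runs_Seq (runs_Mv _ _ _ _ _) _.
  apply: runs_Seq.
    rewrite (drop_nth None lt_v); exact: rF.
  have := runs_Mv i (fun s => (unmark s, MoveRight)) (cmark C v) P (R v.+1).
  by rewrite /= markK // (take_nth None) // rev_rcons.
by have := H (size C) 0 erefl; rewrite take0 drop0.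
Qed.

Lemma prints_For i F (C : seq sym) b P (o : nat -> seq bool) : all cell C ->
  (forall v, v < size C -> prints F b (put i (cmark C v) P) (o v)) ->
  prints (For i F) (size C * (b + 5) + 6) (put i (cstart C) P)
    (flatten (mkseq o (size C))).
Proof.
move=> cC pF z o0.
pose R v := (z, otape (o0 ++ flatten (mkseq o v))).
have <- : R 0 = (z, otape o0) by rewrite /R cats0.
apply: (@runs_For i F C b P R) => // v lt_v.
rewrite /R mkseqS -cats1 flatten_cat /= cats0 catA; exact: pF.
Qed.

Definition walkR_print (i : bool) (g : sym -> bool) : frag :=
  While (fun s => nonblank (get i s.1))
    (Seq (Emit (fun=> false)) (Seq (Emit (fun s => g (get i s.1))) (Mv i goR))).

Lemma runs_walkR_print i g l (C : seq sym) P z o : all nonblank C ->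
  runs (walkR_print i g) (4 * size C + 1) (put i (cur l C) P, (z, otape o))
    (put i (Tape (rev C ++ l) None [::]) P, (z, otape (o ++ dbl (map g C)))).
Proof.
elim: C l o => [|x C IH] l o.
  by rewrite cats0 => _; apply: runs_While0; rewrite get_scan.
case/andP=> nx nC.
have -> : 4 * size (x :: C) + 1 = ((1 + (1 + 1)) + (4 * size C + 1)).+1.
  by rewrite /=; lia.
apply: (runs_WhileS
  (T' := (put i (cur (x :: l) C) P, (z, otape (o ++ [:: false; g x]))))).
- by rewrite get_scan.
- apply: runs_Seq (runs_Emit _ _ _ _) _.
  apply: runs_Seq (runs_Emit _ _ _ _) _.
  rewrite get_scan /= -!cats1 -catA /=.
  exact: (runs_Mv i goR (cur l (x :: C))).
- have := IH (x :: l) (o ++ [:: false; g x]) nC.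
  by rewrite rev_cons cat_rcons -catA.
Qed.

Definition back (i : bool) : frag :=
  While (fun s => ~~ marked (get i s.1)) (Mv i goL).

Lemma runs_back i (a : seq sym) m (b : seq sym) x r P R : marked m -> all (predC marked) (x :: b) ->
  runs (back i) (2 * size b + 3) (put i (Tape (b ++ m :: a) x r) P, R)
    (put i (Tape a m (rev b ++ x :: r)) P, R).
Proof.
move=> mm; elim: b x r => [|y b IH] x r /andP[nx nl].
  apply: (@runs_WhileS _ _ 1 1); first by rewrite get_scan.
    exact: (runs_Mv i goL (Tape (m :: a) x r)).
  by apply: runs_While0; rewrite get_scan /= mm.
rewrite rev_cons cat_rcons.
have -> : 2 * size (y :: b) + 3 = (1 + (2 * size b + 3)).+1 by rewrite /=; lia.
apply: runs_WhileS (IH y (x :: r) nl); first by rewrite get_scan.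
exact: (runs_Mv i goL (Tape (y :: b ++ m :: a) x r)).
Qed.

(** The whole tape is read from its left end, one bit per cell, and the head then finds the current
    cell again by searching leftwards for its mark. With [g := marked] this prints the one-hot code
    of the loop index. *)
Definition Field (i : bool) (g : sym -> bool) : frag :=
  Seq (walkL i) (Seq (Mv i goR) (Seq (walkR_print i g) (back i))).

Definition cmarks (C : seq sym) (v : nat) : seq sym :=
  take v C ++ mark (nth None C v) :: drop v.+1 C.

Lemma size_cmarks (C : seq sym) v : v < size C -> size (cmarks C v) = size C.
Proof.
move=> lt_v; rewrite size_cat /= size_take size_drop lt_v.
by move: lt_v; set n := size C; lia.
Qed.

Lemma prints_Field i g (C : seq sym) v P : all cell C -> v < size C ->
  prints (Field i g) (8 * size C + 11) (put i (cmark C v) P)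
    (dbl (map g (cmarks C v))).
Proof.
move=> cC lt_v z o.
have all_cells (Q : pred sym) : (forall s, cell s -> Q s) -> all Q (take v C) /\ all Q (drop v.+1 C).
  move=> cQ; split; apply: (sub_all cQ).
    by apply/allP => x /mem_take; apply: (allP cC).
  by apply/allP => x /mem_drop; apply: (allP cC).
have [na nb] := all_cells _ cell_nonblank.
have [ma mb] := all_cells _ cell_unmarked.
have sa : size (take v C) = v by rewrite size_take lt_v.
have sb : size (drop v.+1 C) = size C - v.+1 by rewrite size_drop.
have -> : 8 * size C + 11 = (2 * size (rev (take v C)) + 3) + (1 + ((4 * size C + 1)
   + (6 + (4 * size C - 2 * v)))) by rewrite size_rev sa; lia.
apply: runs_Seq.
  by apply: runs_walkL; rewrite /= all_rev.
apply: (runs_Seq (T' := (put i (cur [:: None] (cmarks C v)) P, (z, otape o)))).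
  have := runs_Mv i goR (Tape [::] None (rcons (cmarks C v) None)) P (z, otape o).
  by rewrite revK /cur /cmarks !rcons_cat.
have := @runs_walkR_print i g [:: None] (cmarks C v) P z o.
rewrite (size_cmarks lt_v) all_cat /= na nb => /(_ isT) print.
apply: runs_Seq print _.
rewrite /cmarks rev_cat rev_cons cat_rcons -catA.
apply: runs_weaken.
  have := @runs_back i (rev (take v C) ++ [:: None]) (mark (nth None C v))
    (rev (drop v.+1 C)) None [::] P (z, otape (o ++ dbl (map g (cmarks C v)))).
  rewrite revK !cats1 => H; apply: H => //.
  by rewrite /= all_rev.
by rewrite size_rev sb; move: lt_v; set n := size C; lia.
Qed.

(** * Preparing the counter tapes *)

Definition Push (i : bool) : frag := Mv i (fun=> (filler, MoveRight)).

Lemma runs_Push i C P R :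
  runs (Push i) 1 (put i (cend C) P, R) (put i (cend (rcons C filler)) P, R).
Proof.
have -> : cend (rcons C filler) = tape_act (cend C) (filler, MoveRight).
  by rewrite /cend rev_rcons.
exact: runs_Mv.
Qed.

Definition walkR (i : bool) : frag :=
  While (fun s => nonblank (get i s.1)) (Mv i goR).

Lemma runs_walkR i l (C : seq sym) P R : all nonblank C ->
  runs (walkR i) (2 * size C + 1) (put i (cur l C) P, R)
    (put i (Tape (rev C ++ l) None [::]) P, R).
Proof.
elim: C l => [|x C IH] l; first by move=> _; apply: runs_While0; rewrite get_scan.
case/andP=> nx nC.
have -> : 2 * size (x :: C) + 1 = (1 + (2 * size C + 1)).+1 by rewrite /=; lia.
rewrite rev_cons cat_rcons; apply: runs_WhileS (IH (x :: l) nC).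
  by rewrite get_scan.
exact: (runs_Mv i goR (cur l (x :: C))).
Qed.

Definition MvZ (f : sym -> act) : frag :=
  Do (fun s => (keep2 s.1, (f s.2.1, keep s.2.2))).

Lemma runs_MvZ f P z o :
  runs (MvZ f) 1 (P, (z, o)) (P, (tape_act z (f (scanned z)), o)).
Proof.
have := runs_Do (fun s => (keep2 s.1, (f s.2.1, keep s.2.2))) (P, (z, o)).
by case: P => x y; rewrite /acts /= !tape_act_keep.
Qed.

(** A unary counter. Erasing it leaves recorded blanks to the right of the head, so the emptied tape
    is not the term [blank_tape]; [g] counts these blanks. *)
Definition ztape (m g : nat) : tp := Tape (nseq m filler) None (nseq g None).
Definition ztapeL (m g : nat) : tp :=
  Tape (behead (nseq m filler)) (head None (nseq m filler)) (nseq g None).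

Definition Tick : frag := MvZ (fun=> (filler, MoveRight)).

Lemma runs_Tick P m g o :
  runs Tick 1 (P, (ztape m g, o)) (P, (ztape m.+1 g.-1, o)).
Proof.
have := runs_MvZ (fun=> (filler, MoveRight)) P (ztape m g) o.
by case: g.
Qed.

Definition Transfer : frag :=
  While (fun s => nonblank s.2.1)
    (Seq (MvZ (fun=> (None, MoveLeft))) (Seq (Push false) (Push true))).

Lemma runs_Transfer C0 C1 m g o :
  runs Transfer (4 * m + 1) ((cend C0, cend C1), (ztapeL m g, o))
    ((cend (C0 ++ nseq m filler), cend (C1 ++ nseq m filler)),
     (ztape 0 (m + g), o)).
Proof.
elim: m C0 C1 g => [|m IH] C0 C1 g.
  by rewrite !cats0; apply: runs_While0.
have -> : 4 * m.+1 + 1 = ((1 + (1 + 1)) + (4 * m + 1)).+1 by lia.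
have := IH (rcons C0 filler) (rcons C1 filler) g.+1.
rewrite !cat_rcons -(addSnnS m) => H; apply: runs_WhileS H => //.
apply: runs_Seq (runs_MvZ _ _ _ _) _.
apply: runs_Seq; first exact: (runs_Push false C0 (cend C0, cend C1)).
exact: (runs_Push true C1 (cend (rcons C0 filler), cend C1)).
Qed.

(** The double loop writes one filler per round on the third tape, hence [N * N] in all; moving them
    to the counter tapes lengthens both from [N] to [N + N * N]. *)
Definition Square : frag :=
  Seq (For true (For false Tick))
  (Seq (walkR false) (Seq (walkR true) (Seq (MvZ goL) (Seq Transfer
  (Seq (Rewind false) (Rewind true)))))).

Definition square_cost (N : nat) : nat :=
  (N * ((N * 6 + 6) + 5) + 6)
  + ((2 * N + 1) + ((2 * N + 1) + (1 + ((4 * (N * N) + 1)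
  + ((2 * (N + N * N) + 5) + (2 * (N + N * N) + 5)))))).

Lemma all_cell_nonblank C : all cell C -> all nonblank C.
Proof. exact/sub_all/cell_nonblank. Qed.

Lemma runs_Square (C0 C1 : seq sym) N g o : all cell C0 -> all cell C1 ->
  size C0 = N -> size C1 = N ->
  exists g', runs Square (square_cost N) ((cstart C0, cstart C1), (ztape 0 g, o))
    ((cstart (C0 ++ nseq (N * N) filler), cstart (C1 ++ nseq (N * N) filler)),
     (ztape 0 g', o)).
Proof.
(* The ticks use up blanks among the [g], the step to the left adds one, and each filler erased adds
   one more. *)
move=> c0 c1 s0 s1; exists (N * N + (g - N * N).+1).
have nf : all nonblank (nseq (N * N) filler) by rewrite all_nseq orbT.
apply: (runs_Seq (T' := ((cstart C0, cstart C1), (ztape (N * N) (g - N * N), o)))).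
  have := @runs_For true (For false Tick) C1 (N * 6 + 6) (cstart C0, cstart C1)
    (fun v => (ztape (v * N) (g - v * N), o)) c1.
  rewrite s1 mul0n subn0; apply=> v lt_v.
  have := @runs_For false Tick C0 1 (cstart C0, cmark C1 v)
    (fun u => (ztape (v * N + u) (g - (v * N + u)), o)) c0.
  rewrite s0 addn0 -mulSnr; apply=> u lt_u.
  by rewrite addnS subnS; apply: runs_Tick.
apply: runs_Seq.
  have := @runs_walkR false [:: None] C0 (cstart C0, cstart C1).
  by rewrite cats1 s0; apply; apply: all_cell_nonblank.
apply: runs_Seq.
  have := @runs_walkR true [:: None] C1 (cend C0, cstart C1).
  by rewrite cats1 s1; apply; apply: all_cell_nonblank.
apply: runs_Seq (runs_MvZ _ _ _ _) _.
apply: runs_Seq (runs_Transfer C0 C1 (N * N) (g - N * N).+1 o) _.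
have sz (C : seq sym) : size C = N -> size (C ++ nseq (N * N) filler) = N + N * N.
  by move=> sC; rewrite size_cat size_nseq sC.
apply: runs_Seq.
  have := @runs_Rewind false (C0 ++ nseq (N * N) filler)
    (cend C0, cend (C1 ++ nseq (N * N) filler)).
  by rewrite sz //; apply; rewrite all_cat all_cell_nonblank.
have := @runs_Rewind true (C1 ++ nseq (N * N) filler)
    (cstart (C0 ++ nseq (N * N) filler), cend (C1 ++ nseq (N * N) filler)).
by rewrite sz //; apply; rewrite all_cat all_cell_nonblank.
Qed.

(* The input tape carries the loop index [j], the first extra tape the loop
   index [t]; the bit in the first cell of the latter tells [t = 0] apart. *)
Definition jcells (w : seq bool) (N : nat) : seq sym :=
  map bit w ++ nseq (N - size w) filler.
Definition tcells (N : nat) : seq sym := bit true :: nseq N.-1 filler.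

Lemma jcells_cells w N : all cell (jcells w N).
Proof.
by rewrite all_cat all_nseq orbT andbT all_map; apply/allP.
Qed.

Lemma tcells_cells N : all cell (tcells N).
Proof. by rewrite /= all_nseq orbT. Qed.

Lemma size_jcells w N : size w <= N -> size (jcells w N) = N.
Proof. by move=> le_w; rewrite size_cat size_nseq size_map subnKC. Qed.

Lemma size_tcells N : 0 < N -> size (tcells N) = N.
Proof. by case: N => //= N; rewrite size_nseq. Qed.

(** The moves to and fro record the blank at the left end. The length becomes [(size w).+2], hence
    at least 2 even for the empty word, so that powers of it dominate every polynomial. *)
Definition Start : frag :=
  Seq (Mv false goL) (Seq (Mv false goR) (Seq (Mv true goR)
  (Seq (Mv true (fun=> (bit true, MoveRight)))
  (Seq (While (fun s => nonblank s.1.1) (Seq (Mv false goR) (Push true)))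
  (Seq (Push false) (Seq (Push false) (Seq (Push true)
  (Seq (Rewind false) (Rewind true))))))))).

Lemma runs_Start w o :
  runs Start (7 * size w + 26) ((input_tape aux w, blank_tape aux), (ztape 0 0, o))
    ((cstart (jcells w (size w).+2), cstart (tcells (size w).+2)), (ztape 0 0, o)).
Proof.
set n := size w.
have -> : 7 * n + 26 = 1 + (1 + (1 + (1 + ((3 * n + 1) + (1 + (1 + (1
  + ((2 * n.+2 + 5) + (2 * n.+2 + 5))))))))) by lia.
pose s := map bit w.
have js : jcells w n.+2 = rcons (rcons s filler) filler.
  by rewrite /jcells -/n !subSn // subnn -cats1 -cats1 -catA.
have ts : tcells n.+2 = rcons (bit true :: nseq n filler) filler.
  by rewrite -cats1 /= -[[:: filler]]/(nseq 1 filler) -nseqD addn1.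
pose x0 := Tape [:: None] (head None s) (behead s).
pose y := blank_tape aux.
apply: runs_Seq; first exact: (runs_Mv false goL (input_tape aux w) (y, y)).
apply: runs_Seq.
  exact: (runs_Mv false goR (Tape [::] None (head None s :: behead s)) (y, y)).
apply: runs_Seq; first exact: (runs_Mv true goR y (x0, y)).
apply: runs_Seq.
  exact: (runs_Mv true (fun=> (bit true, MoveRight)) (Tape [:: None] None [::]) (x0, y)).
apply: (runs_Seq (T' := ((cend s, cend (bit true :: nseq n filler)), (ztape 0 0, o)))).
  have H : forall (v : seq bool) l C,
    runs (While (fun s => nonblank s.1.1) (Seq (Mv false goR) (Push true)))
      (3 * size v + 1)
      ((Tape l (head None (map bit v)) (behead (map bit v)), cend C), (ztape 0 0, o))
      ((Tape (rev (map bit v) ++ l) None [::], cend (C ++ nseq (size v) filler)),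
       (ztape 0 0, o)).
    elim=> [|b v IH] l C; first by rewrite cats0; apply: runs_While0.
    have -> : 3 * size (b :: v) + 1 = ((1 + 1) + (3 * size v + 1)).+1.
      by rewrite /=; lia.
    have := IH (bit b :: l) (rcons C filler).
    rewrite cat_rcons /= rev_cons cat_rcons => H; apply: runs_WhileS H => //.
    apply: runs_Seq.
      exact: (runs_Mv false goR (Tape l (bit b) (map bit v)) (y, cend C)).
    exact: (runs_Push true C
      (Tape (bit b :: l) (head None (map bit v)) (behead (map bit v)), cend C)).
  by have := H w [:: None] [:: bit true]; rewrite cats1.
set y1 := cend (bit true :: _).
apply: runs_Seq; first exact: (runs_Push false s (y, y1)).
apply: runs_Seq; first exact: (runs_Push false (rcons s filler) (y, y1)).
apply: runs_Seq.
  exact: (runs_Push true _ (cend (rcons (rcons s filler) filler), y1)).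
rewrite -js -ts.
apply: runs_Seq.
  have := @runs_Rewind false (jcells w n.+2) (y, cend (tcells n.+2)) (ztape 0 0, o).
  rewrite size_jcells ?leqW //; apply; exact: all_cell_nonblank (jcells_cells _ _).
have := @runs_Rewind true (tcells n.+2) (cstart (jcells w n.+2), y) (ztape 0 0, o).
by rewrite size_tcells //; apply; exact: all_cell_nonblank (tcells_cells _).
Qed.

Fixpoint Grow (e : nat) : frag :=
  if e is e'.+1 then Seq Square (Grow e') else Skip.

Fixpoint grow (e N : nat) : nat := if e is e'.+1 then grow e' (N + N * N) else N.
Fixpoint grow_cost (e N : nat) : nat :=
  if e is e'.+1 then square_cost N + grow_cost e' (N + N * N) else 1.

Lemma runs_Grow e w N g o : size w <= N -> 0 < N ->
  exists g', runs (Grow e) (grow_cost e N)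
    ((cstart (jcells w N), cstart (tcells N)), (ztape 0 g, o))
    ((cstart (jcells w (grow e N)), cstart (tcells (grow e N))), (ztape 0 g', o)).
Proof.
elim: e N g => [|e IH] N g le_w N0; first by exists g; apply: runs_Skip.
have [g1 r1] := @runs_Square (jcells w N) (tcells N) N g o (jcells_cells w N)
  (tcells_cells N) (size_jcells le_w) (size_tcells N0).
have [|| g2 r2] := IH (N + N * N) g1; [lia | lia |].
exists g2; apply: runs_Seq r2.
have -> : jcells w (N + N * N) = jcells w N ++ nseq (N * N) filler.
  by rewrite /jcells -catA -nseqD; congr (_ ++ nseq _ _); lia.
have -> // : tcells (N + N * N) = tcells N ++ nseq (N * N) filler.
by rewrite /tcells /= -nseqD; congr (_ :: nseq _ _); lia.
Qed.

(** * Rewinding the output *)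

Definition MvO (f : sym -> act) : frag :=
  Do (fun s => (keep2 s.1, (keep s.2.1, f s.2.2))).

Lemma runs_MvO f P z o :
  runs (MvO f) 1 (P, (z, o)) (P, (z, tape_act o (f (scanned o)))).
Proof.
have := runs_Do (fun s => (keep2 s.1, (keep s.2.1, f s.2.2))) (P, (z, o)).
by case: P => x y; rewrite /acts /= !tape_act_keep.
Qed.

Definition Finish : frag :=
  Seq (MvO goL) (Seq (While (fun s => nonblank s.2.2) (MvO goL)) (MvO goR)).

Lemma bit_prefix_bits o (r : seq sym) : bit_prefix (map bit o ++ None :: r) = o.
Proof. by elim: o => //= b o ->. Qed.

Lemma runs_Finish P z o :
  exists2 x, runs Finish (2 * size o + 5) (P, (z, otape o)) (P, (z, x))
    & tape_output x = o.
Proof.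
exists (cur [:: None] (map bit o)); last first.
  by case: o => [|b o] //; rewrite /tape_output /= -cats1 bit_prefix_bits.
have -> : 2 * size o + 5 = 1 + ((2 * size o + 3) + 1) by lia.
apply: runs_Seq (runs_MvO _ _ _ _) _.
apply: (runs_Seq (T' := (P, (z, Tape [::] None (rcons (map bit o) None)))));
  last exact: runs_MvO.
case/lastP: o => [|o b].
  by apply: (@runs_weaken _ 1) => //; apply: runs_While0.
rewrite /otape map_rcons rev_rcons /=.
have H : forall (l : seq sym) x r, all nonblank (x :: l) ->
  runs (While (fun s => nonblank s.2.2) (MvO goL)) (2 * size l + 3)
    (P, (z, Tape l x r)) (P, (z, Tape [::] None (rev l ++ x :: r))).
  elim=> [|y l IH] x r /andP[nx nl].
    apply: (@runs_WhileS _ _ 1 1); first by [].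
      exact: (runs_MvO goL P z (Tape [::] x r)).
    exact: runs_While0.
  have -> : 2 * size (y :: l) + 3 = (1 + (2 * size l + 3)).+1 by rewrite /=; lia.
  rewrite rev_cons cat_rcons; apply: runs_WhileS (IH y (x :: r) nl) => //.
  exact: (runs_MvO goL P z (Tape (y :: l) x r)).
have := H (rev (map bit o)) (bit b) [:: None].
rewrite revK size_rev size_map => /(_ _)/runs_weaken H'.
rewrite -!cats1 -catA; apply: H'; last by rewrite size_cat /=; lia.
by rewrite /= all_rev all_map; apply/allP.
Qed.

(** A step records at most one more cell to the left of the head. The cost of rewinding the output
    is thereby bounded by the time spent on printing it. *)
Lemma runs_output_size F B P z o P' z' o' :
  runs F B (P, (z, otape o)) (P', (z', otape o')) -> size o' <= size o + B.
Proof.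
case=> n le_n r.
suff : size (left_of (otape o')) <= size (left_of (otape o)) + n.
  by rewrite /= !size_rev !size_map => /leq_trans; apply; rewrite leq_add2l.
have act_size (t : tp) a : size (left_of (tape_act t a)) <= (size (left_of t)).+1.
  by case: t a => l s r' [x []] /=; rewrite ?size_behead; move: (size l) => k; lia.
rewrite -[otape o]/((P, (z, otape o)).2.2) -[otape o']/((P', (z', otape o')).2.2).
elim: r => {le_n n} [q T a _ | q q' T a n T' _ _ IH].
  by rewrite addn1; apply: act_size.
apply: leq_trans IH _; rewrite addnS -addSn leq_add2r; exact: act_size.
Qed.

(** * Polynomial bounds *)

Definition poly_bounded (f : nat -> nat) : Prop :=
  exists a d, forall n, f n <= a * n ^ d + a.

Lemma poly_bounded_le f g : poly_bounded g -> (forall n, f n <= g n) -> poly_bounded f.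
Proof. by move=> [a [d H]] le_fg; exists a, d => n; apply: leq_trans (H n). Qed.

Lemma poly_bounded_const c : poly_bounded (fun=> c).
Proof. by exists c, 0 => n; rewrite leq_addl. Qed.

Lemma poly_bounded_id : poly_bounded id.
Proof. by exists 1, 1 => n; rewrite expn1 mul1n leq_addr. Qed.

(** The summand 1 pays for [0 ^ 0 = 1], the only case in which a larger exponent gives a smaller
    power. *)
Lemma leq_expn_addr n d d' : n ^ d <= n ^ (d + d') + 1.
Proof.
case: n => [|n]; first by case: d => [|d]; [apply: leq_addl | rewrite exp0n].
by rewrite expnD -[leqLHS]muln1; apply: leq_trans (leq_addr _ _);
  rewrite leq_mul2l expn_gt0 orbT.
Qed.

Lemma poly_bounded_add f g :
  poly_bounded f -> poly_bounded g -> poly_bounded (fun n => f n + g n).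
Proof.
move=> [a [d Hf]] [b [k Hg]]; exists (2 * (a + b)), (d + k) => n.
have := leq_expn_addr n d k; have := leq_expn_addr n k d; rewrite (addnC k d).
have := Hf n; have := Hg n.
move: (n ^ (d + k)) (n ^ d) (n ^ k) (f n) (g n) => x y z u v *; nia.
Qed.

Lemma poly_bounded_mul f g :
  poly_bounded f -> poly_bounded g -> poly_bounded (fun n => f n * g n).
Proof.
move=> [a [d Hf]] [b [k Hg]]; exists (4 * (a * b)), (d + k) => n.
apply: leq_trans (leq_mul (Hf n) (Hg n)) _.
have := leq_expn_addr n d k; have := leq_expn_addr n k d; rewrite (addnC k d).
have := expnD n d k.
move: (n ^ (d + k)) (n ^ d) (n ^ k) => x y z -> H1 H2.
have -> : (a * y + a) * (b * z + b) = a * b * (y * z + y + z + 1) by nia.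
have -> : 4 * (a * b) * (y * z) + 4 * (a * b) = a * b * (4 * (y * z) + 4) by nia.
by rewrite leq_mul2l; apply/orP; right; lia.
Qed.

Lemma poly_bounded_exp f d : poly_bounded f -> poly_bounded (fun n => f n ^ d).
Proof.
move=> pf; elim: d => [|d IH]; first by apply: poly_bounded_const 1.
by apply: poly_bounded_le (poly_bounded_mul pf IH) _ => n; rewrite expnS.
Qed.

Lemma poly_bounded_comp f g :
  poly_bounded f -> poly_bounded g -> poly_bounded (fun n => f (g n)).
Proof.
move=> [a [d Hf]] pg; apply: (poly_bounded_le _ (fun n => Hf (g n))).
apply: poly_bounded_add; last exact: poly_bounded_const.
apply: poly_bounded_mul; first exact: poly_bounded_const.
exact: poly_bounded_exp.
Qed.

Lemma poly_bounded_sumn X (c : X -> nat -> nat) (s : seq X) :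
  (forall x, poly_bounded (c x)) ->
  poly_bounded (fun n => sumn [seq c x n | x <- s]).
Proof.
move=> pc; elim: s => [|x s IH] /=; first exact: poly_bounded_const.
exact: poly_bounded_add.
Qed.

Ltac poly := repeat first
  [ assumption | exact: poly_bounded_id | exact: poly_bounded_const
  | apply: poly_bounded_add | apply: poly_bounded_mul ].

Lemma poly_bounded_S f : poly_bounded f -> poly_bounded (fun n => (f n).+1).
Proof.
move=> pf; apply: poly_bounded_le (poly_bounded_add pf (poly_bounded_const 1)) _.
by move=> n; rewrite addn1.
Qed.

Lemma poly_bounded_square_cost : poly_bounded square_cost.
Proof. by rewrite /square_cost; poly. Qed.

Lemma poly_bounded_grow e : poly_bounded (grow e).
Proof.
elim: e => [|e IH] /=; first exact: poly_bounded_id.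
by apply: (poly_bounded_comp IH); poly.
Qed.

Lemma poly_bounded_grow_cost e : poly_bounded (grow_cost e).
Proof.
elim: e => [|e IH] /=; first exact: poly_bounded_const.
apply: poly_bounded_add; first exact: poly_bounded_square_cost.
by apply: (poly_bounded_comp IH); poly.
Qed.

Lemma grow_ge e N : N <= grow e N.
Proof.
by elim: e N => //= e IH N; apply: leq_trans (IH _); rewrite leq_addr.
Qed.

Lemma grow_ge_exp e N : N ^ (2 ^ e) <= grow e N.
Proof.
elim: e N => [|e IH] N /=; first by rewrite expn1.
apply: leq_trans (IH _); rewrite expnS expnM leq_exp2r ?expn_gt0 //.
by rewrite -mulnn leq_addl.
Qed.

(** The number of squarings depends only on the polynomial, so it can be built into the program. The
    margin of 2 puts [N] strictly beyond the last step of any run. *)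
Lemma grow_dominates a d : exists e, forall n, a * n ^ d + a + 2 <= grow e n.+2.
Proof.
(* As the base is at least 2, [a] factors absorb the coefficient, [d] factors the power, and one
   factor the remaining 2. *)
exists (a + d + 1) => n; apply: leq_trans (grow_ge_exp _ _).
apply: leq_trans (_ : n.+2 ^ (a + d + 1) <= _); last first.
  by rewrite leq_pexp2l // ltnW // ltn_expl.
have hA : a.+1 <= n.+2 ^ a.
  by case: a => // a; apply: leq_trans (ltn_expl a.+1 (ltnSn 1)) _; rewrite leq_exp2r.
have hD : n ^ d <= n.+2 ^ d by case: d => // d; rewrite leq_exp2r // leqW.
have hD0 : 0 < n.+2 ^ d by rewrite expn_gt0.
rewrite !expnD expn1; move: (n.+2 ^ a) (n.+2 ^ d) (n ^ d) hA hD hD0 => A D x hA hD hD0.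
apply: leq_trans (_ : A * D * 2 <= _); last by rewrite leq_mul2l orbC.
apply: leq_trans (_ : a.+1 * D * 2 <= _); last by rewrite !leq_mul2r hA orbT.
by nia.
Qed.

(** * Printing jobs *)

(* A job is given by the bits of its times, least significant bit first, as a
   function of the indices [t] and [j].  [Fld i (Off m)] is the one-hot code of
   [m] plus the index on tape [i], [Fld i (Const m)] that of [m], and [Nul i]
   is a string of zeros of the same length. *)
Inductive mode := Off of nat | Const of nat.
Inductive piece := Cst of seq bool | Fld of bool & mode | Nul of bool.

Definition onehot (W x : nat) : seq bool := mkseq (fun u => u == x) W.

Definition index_of (i : bool) (t j : nat) : nat := if i then t else j.

Definition piece_bits (N t j : nat) (p : piece) : seq bool :=
  match p with
  | Cst s => s
  | Fld i (Off m) =>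
      nseq m false ++ onehot N (index_of i t j) ++ nseq (2 - m) false
  | Fld i (Const m) => onehot 2 m ++ nseq N false
  | Nul i => nseq 2 false ++ nseq N false
  end.

Definition time_bits (N t j : nat) (ps : seq piece) : seq bool :=
  flatten (map (piece_bits N t j) ps).

Definition encode_bits (s : seq bool) : seq bool := dbl s ++ [:: true; false].
Definition encode_bits_job (ss : seq (seq bool)) : seq bool :=
  flatten (map encode_bits ss) ++ [:: true; true].

Definition DBits (s : seq bool) : frag := Raw (dbl s).

Definition piece_prog (p : piece) : frag :=
  match p with
  | Cst s => DBits s
  | Fld i (Off m) =>
      Seq (DBits (nseq m false)) (Seq (Field i marked) (DBits (nseq (2 - m) false)))
  | Fld i (Const m) => Seq (DBits (onehot 2 m)) (Field i (fun=> false))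
  | Nul i => Seq (DBits (nseq 2 false)) (Field i (fun=> false))
  end.

Definition raw_cost (s : seq bool) : nat := (size (dbl s)).+1.

Definition piece_cost (p : piece) (N : nat) : nat :=
  match p with
  | Cst s => raw_cost s
  | Fld i (Off m) =>
      raw_cost (nseq m false) + ((8 * N + 11) + raw_cost (nseq (2 - m) false))
  | Fld i (Const m) => raw_cost (onehot 2 m) + (8 * N + 11)
  | Nul i => raw_cost (nseq 2 false) + (8 * N + 11)
  end.

Definition time_prog (ps : seq piece) : frag :=
  Seq (Block (map piece_prog ps)) (Raw [:: true; false]).
Definition time_cost (ps : seq piece) (N : nat) : nat :=
  (sumn [seq piece_cost p N | p <- ps]).+1 + 3.

Definition job_prog (ts : seq (seq piece)) : frag :=
  Seq (Block (map time_prog ts)) (Raw [:: true; true]).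
Definition job_cost (ts : seq (seq piece)) (N : nat) : nat :=
  (sumn [seq time_cost ps N | ps <- ts]).+1 + 3.

Lemma poly_bounded_job_cost ts : poly_bounded (job_cost ts).
Proof.
apply: poly_bounded_add; last exact: poly_bounded_const.
apply/poly_bounded_S/poly_bounded_sumn => ps.
apply: poly_bounded_add; last exact: poly_bounded_const.
by apply/poly_bounded_S/poly_bounded_sumn => -[s|i [m|m]|i] /=; poly.
Qed.

Lemma onehotE W x : x < W -> onehot W x = nseq x false ++ true :: nseq (W - x.+1) false.
Proof.
move=> lt_x; apply: (@eq_from_nth _ false).
  by rewrite size_mkseq size_cat /= !size_nseq; lia.
move=> u; rewrite size_mkseq => lt_u; rewrite nth_mkseq // nth_cat size_nseq nth_nseq.
have [lt_ux|lt_xu|->] := ltngtP u x; rewrite ?subnn //.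
have -> : u - x = (u - x.+1).+1 by lia.
by rewrite /= nth_nseq if_same.
Qed.

Lemma map_marked_cmarks (C : seq sym) v : all cell C -> v < size C ->
  map marked (cmarks C v) = onehot (size C) v.
Proof.
move=> cC lt_v; rewrite onehotE // /cmarks map_cat /=.
have U (s : seq sym) : {subset s <= C} -> map marked s = nseq (size s) false.
  elim: s => //= x s IH sub; rewrite IH => [|y sy]; last by apply: sub; rewrite inE sy orbT.
  by rewrite (negbTE (cell_unmarked (allP cC _ (sub x (mem_head _ _))))).
by rewrite !U; [rewrite size_take size_drop lt_v | move=> x /mem_drop | move=> x /mem_take].
Qed.

Section Printing.

Variables (C0 C1 : seq sym) (N t j : nat).
Hypotheses (c0 : all cell C0) (c1 : all cell C1).
Hypotheses (s0 : size C0 = N) (s1 : size C1 = N) (lt_j : j < N) (lt_t : t < N).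

Let P := (cmark C0 j, cmark C1 t).

Lemma prints_Field_at i (g : sym -> bool) :
  prints (Field i g) (8 * N + 11) P
    (dbl (map g (cmarks (if i then C1 else C0) (index_of i t j)))).
Proof.
case: i; first by have := @prints_Field true g C1 t P c1; rewrite s1; apply.
by have := @prints_Field false g C0 j P c0; rewrite s0; apply.
Qed.

Lemma prints_piece p :
  prints (piece_prog p) (piece_cost p N) P (dbl (piece_bits N t j p)).
Proof.
have lt_i i : index_of i t j < size (if i then C1 else C0).
  by case: i; rewrite ?s0 ?s1.
have size_i i : size (if i then C1 else C0) = N by case: i.
have cell_i i : all cell (if i then C1 else C0) by case: i.
have zero i : prints (Field i (fun=> false)) (8 * N + 11) P (dbl (nseq N false)).
  have := @prints_Field_at i (fun=> false).
  rewrite (_ : map _ _ = nseq N false) //.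
  by rewrite -[in RHS](size_i i) -(size_cmarks (lt_i i)); elim: (cmarks _ _) => //= x s ->.
case: p => [s|i [m|m]|i]; first exact: prints_Raw.
- rewrite /= !dbl_cat; apply: prints_Seq; first exact: prints_Raw.
  apply: prints_Seq; last exact: prints_Raw.
  by have := @prints_Field_at i marked; rewrite map_marked_cmarks // size_i.
- by rewrite /piece_bits dbl_cat; apply: prints_Seq; [exact: prints_Raw | exact: zero].
- by rewrite /piece_bits dbl_cat; apply: prints_Seq; [exact: prints_Raw | exact: zero].
Qed.

Lemma prints_time ps :
  prints (time_prog ps) (time_cost ps N) P (encode_bits (time_bits N t j ps)).
Proof.
apply: prints_Seq (prints_Raw _ _).
have -> : dbl (time_bits N t j ps) = flatten [seq dbl (piece_bits N t j p) | p <- ps].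
  by elim: ps => //= p ps IH; rewrite /time_bits /= dbl_cat -IH.
exact: (prints_Block _ prints_piece).
Qed.

Lemma prints_job ts :
  prints (job_prog ts) (job_cost ts N) P
    (encode_bits_job (map (time_bits N t j) ts)).
Proof.
apply: prints_Seq (prints_Raw _ _); rewrite -map_comp.
exact: (prints_Block _ prints_time).
Qed.

End Printing.

(** * The machine of a template *)

(* The guard [Some x] restricts a job to [t = 0] and to those [j] for which [x]
   is the input bit number [j], or [None] beyond the end of the input. *)
Definition active (w : seq bool) (t j : nat) (g : option (option bool)) : bool :=
  if g is Some x then (t == 0) && (nth None (map Some w) j == x) else true.

(** On the tape of [t] only cell 0 holds a bit, so the first test recognizes [t = 0]; on the tape of
    [j] the mark preserves the input bit. *)
Definition guard_test (g : option (option bool)) (s : quad sym) : bool :=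
  if g is Some x then (orig s.1.2 == Some true) && (orig s.1.1 == x) else true.

Section Template.

Variables (S : Type) (jobs : seq S) (guard : S -> option (option bool)).
Variable job : S -> seq (seq piece).

Definition template_out (w : seq bool) (N : nat) : seq bool :=
  flatten (mkseq (fun t => flatten (mkseq (fun j =>
    flatten [seq if active w t j (guard s)
                 then encode_bits_job (map (time_bits N t j) (job s))
                 else [::] | s <- jobs]) N)) N).

Definition Template : frag :=
  For true (For false
    (Block [seq When (guard_test (guard s)) (job_prog (job s)) | s <- jobs])).

Definition template_body_cost (N : nat) : nat :=
  (sumn [seq (job_cost (job s) N).+1 | s <- jobs]).+1.
Definition template_cost (N : nat) : nat :=
  N * ((N * (template_body_cost N + 5) + 6) + 5) + 6.

Lemma poly_bounded_template_cost : poly_bounded template_cost.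
Proof.
have pb : poly_bounded template_body_cost.
  apply/poly_bounded_S/poly_bounded_sumn => s.
  exact/poly_bounded_S/poly_bounded_job_cost.
by rewrite /template_cost; poly.
Qed.

Lemma prints_Template w N : size w <= N -> 0 < N ->
  prints Template (template_cost N) (cstart (jcells w N), cstart (tcells N))
    (template_out w N).
Proof.
move=> le_w N0.
have := size_jcells le_w; have := size_tcells N0.
set C0 := jcells w N; set C1 := tcells N => s1 s0.
have c0 : all cell C0 := jcells_cells w N; have c1 : all cell C1 := tcells_cells N.
have := @prints_For true _ C1 (N * (template_body_cost N + 5) + 6)
  (cstart C0, cstart C1) _ c1; rewrite s1; apply=> t lt_t.
have := @prints_For false _ C0 (template_body_cost N) (cstart C0, cmark C1 t) _ c0.
rewrite s0; apply=> j lt_j.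
apply: prints_Block => s z o.
have E : guard_test (guard s) (scan ((cmark C0 j, cmark C1 t), (z, otape o)))
    = active w t j (guard s).
  case: (guard s) => //= x; congr (_ && (_ == x)).
    by case: (t) => //= t'; rewrite nth_nseq; case: ifP.
  rewrite nth_cat size_map; case: ltnP => [lt_jw|le_jw].
    by rewrite (nth_map false) // (nth_map false).
  by rewrite [RHS]nth_default ?size_map // nth_nseq; case: ifP.
case: ifP => act.
  apply: runs_When1; first by rewrite E act.
  exact: prints_job.
rewrite cats0; apply: (@runs_weaken _ 1) => //.
by apply: runs_When0; rewrite E act.
Qed.

Theorem template_computable e :
  polynomial_time_computable (fun w => template_out w (grow e (size w).+2)).
Proof.
pose c n := (7 * n + 26) + (grow_cost e n.+2 + template_cost (grow e n.+2)).
apply: (@frag_machine_computes _ (Seq (Seq Start (Seq (Grow e) Template)) Finish)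
  (fun n => c n + (2 * c n + 5))).
  have pS : poly_bounded (fun n => n.+2).
    by do 2 apply: poly_bounded_S; apply: poly_bounded_id.
  have pc : poly_bounded c.
    apply: poly_bounded_add; first by poly.
    apply: poly_bounded_add.
      exact: (poly_bounded_comp (poly_bounded_grow_cost e) pS).
    apply: (poly_bounded_comp poly_bounded_template_cost).
    exact: (poly_bounded_comp (poly_bounded_grow e) pS).
  by poly.
move=> w; set n := size w; set N := grow e n.+2.
have leN : n.+2 <= N by apply: grow_ge.
have [g r] := @runs_Grow e w n.+2 0 (otape [::]) (leqW (leqnSn _)) isT.
have pr := @prints_Template w N (ltnW (ltnW leN)) (leq_trans _ leN) (ztape 0 g) [::].
have := runs_Seq (runs_Start w (otape [::])) (runs_Seq r (pr isT)).
rewrite cat0s -/n -/N -/(c n) => r1.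
have [x r2 out] := runs_Finish (cstart (jcells w N), cstart (tcells N))
  (ztape 0 g) (template_out w N).
exists ((cstart (jcells w N), cstart (tcells N)), (ztape 0 g, x)); last exact: out.
have le_out := runs_output_size r1.
apply: (runs_Seq r1); apply: runs_weaken r2 _.
by rewrite leq_add2r leq_mul2l.
Qed.

End Template.

(** * Exploring a star is selecting disjoint intervals *)

Definition leaf_of n (e : edge (star n)) : option 'I_n :=
  [pick i | Some i \in (val e : {set option 'I_n})].

Lemma leaf_of_star_edge n (i : 'I_n) : leaf_of (star_edge i) = Some i.
Proof.
rewrite /leaf_of; case: pickP => [k|/(_ i)]; last by rewrite !inE eqxx orbT.
by rewrite !inE /= => /eqP[->].
Qed.

Lemma edge_of_leaf n (e : edge (star n)) (i : 'I_n) :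
  val e = [set center n; leaf i] -> e = star_edge i.
Proof. by move=> E; apply: val_inj. Qed.

Lemma star_edge_pair n (e : edge (star n)) (x y : option 'I_n) :
  val e = [set x; y] -> (x == None) != (y == None).
Proof.
move=> E; have := valP e; rewrite /is_edge E => /existsP[a /existsP[b /andP[ab /eqP Eab]]].
have /set2P xab : x \in [set a; b] by rewrite -Eab set21.
have /set2P yab : y \in [set a; b] by rewrite -Eab set22.
have /set2P axy : a \in [set x; y] by rewrite Eab set21.
have /set2P bxy : b \in [set x; y] by rewrite Eab set22.
move: ab; rewrite /adj /= /star_adj => ab.
case: xab axy bxy => Ex; case: yab => Ey axy bxy; rewrite Ex Ey //.
- by move: ab; case: bxy => ->; rewrite ?Ex ?Ey eqxx.
- by rewrite eq_sym.
- by move: ab; case: axy => ->; rewrite ?Ex ?Ey eqxx.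
Qed.

(** Each edge has exactly one end at the center, so a closed walk splits into pairs of steps, out to
    a leaf and back along the same edge. *)
Lemma star_temporal_walk_visits n (tau : time_labelling (star n)) W p :
  temporal_walk tau (center n) (center n) W p ->
  exists V : seq ('I_n * (nat * nat)),
    [/\ p = flatten [seq [:: Some v.1; None] | v <- V],
        unzip2 W = flatten [seq [:: v.2.1; v.2.2] | v <- V]
      & forall v, v \in V ->
          (v.2.1 \in tau (star_edge v.1)) && (v.2.2 \in tau (star_edge v.1))].
Proof.
case=> inW walk lastp _.
have [m] := ubnP (size p); elim: m p W inW walk lastp => // m IH p W inW walk lastp.
case: p W inW walk lastp => [|y [|y' p]] [|[e1 t1] [|[e2 t2] W]] inW //=.
- by exists [::].
- by case/andP=> /eqP/star_edge_pair H _ /= E; move: H; rewrite E.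
- by case/andP.
- by case/andP.
case/and3P=> /eqP E1 /eqP E2 walk lastp le_m.
have := star_edge_pair E1; case: y E1 E2 => // i E1 E2 _.
have := star_edge_pair E2; case: y' E2 walk lastp => // E2 walk lastp _.
have [||V [-> EW inV]] := IH p W _ walk lastp.
- by move=> e t eW; apply: inW; rewrite !inE eW !orbT.
- by move: le_m; rewrite ltnS => /ltnW.
exists ((i, (t1, t2)) :: V); split=> //=; first by rewrite EW.
move=> v; rewrite inE => /predU1P[->|/inV //] /=.
have e2E : e2 = star_edge i by apply: edge_of_leaf; apply: etrans E2 (setUC _ _).
by apply/andP; split; [rewrite -(edge_of_leaf E1) | rewrite -e2E];
  apply: inW; rewrite !inE eqxx ?orbT.
Qed.

Definition before (a b : nat * nat) : bool := a.2 < b.1.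
Definition disjoint_intervals (a b : nat * nat) : bool := before a b || before b a.

Lemma disjoint_intervals_sym a b : disjoint_intervals a b = disjoint_intervals b a.
Proof. by rewrite /disjoint_intervals orbC. Qed.

Definition interval_of (ts : seq nat) (a : nat * nat) : bool :=
  [&& a.1 \in ts, a.2 \in ts & a.1 < a.2].

Lemma pairwise_before (I : Type) (V : seq (I * (nat * nat))) :
  pairwise ltn (flatten [seq [:: v.2.1; v.2.2] | v <- V]) ->
  pairwise (fun v v' => before v.2 v'.2) V && all (fun v => v.2.1 < v.2.2) V.
Proof.
elim: V => //= v V IH /and3P[/andP[-> _] H /IH /andP[-> ->]].
rewrite !andbT; move: H; elim: V {IH} => //= u V IH /and3P[H _ /IH ->].
by rewrite /before (H : _ < _).
Qed.

Lemma explorable_intervals n (tau : time_labelling (star n)) :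
  explorable tau <->
  exists g : 'I_n -> nat * nat,
    (forall i, [&& (g i).1 \in tau (star_edge i), (g i).2 \in tau (star_edge i)
                 & (g i).1 < (g i).2]) /\
    (forall i k, i != k -> disjoint_intervals (g i) (g k)).
Proof.
split=> [[W [p [tw vis]]]|[g [gP gD]]].
  have [V [Ep EW inV]] := star_temporal_walk_visits tw.
  case: tw => _ _ _; rewrite (sorted_pairwise ltn_trans) EW.
  case/pairwise_before/andP => /pairwiseP pw /allP lt_V.
  have inV1 i : i \in map fst V.
    have := vis i; rewrite inE /= Ep => /flattenP[s /mapP[v vV ->]].
    by rewrite !inE orbF => /eqP[->]; apply: map_f.
  (* A leaf may be visited several times; [index] keeps its first visit. *)
  pose x0 (i : 'I_n) := (i, (0, 0)); pose k i := index i (map fst V).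
  have lt_k i : k i < size V by rewrite -(size_map fst) index_mem.
  have nth_k i z : (nth z V (k i)).1 = i by rewrite -(nth_map _ i) // nth_index.
  exists (fun i => (nth (x0 i) V (k i)).2); split=> [i|i j ne_ij].
    have kV : nth (x0 i) V (k i) \in V by apply: mem_nth.
    by have /andP[] := inV _ kV; rewrite nth_k => -> ->; rewrite lt_V.
  rewrite (set_nth_default (x0 i) (x0 j)) //.
  have ne_k : k i != k j.
    by apply: contra ne_ij => /eqP E; rewrite -(nth_k i (x0 i)) E nth_k.
  rewrite /disjoint_intervals; case: ltngtP ne_k => // lt_ij _.
    by rewrite (pw (x0 i) _ _ _ _ lt_ij) ?inE.
  by rewrite (pw (x0 i) _ _ _ _ lt_ij) ?inE ?orbT.
pose s i := (g i).1.
(* Disjoint intervals have distinct starting times, and sorting by these gives the order in which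
   the walk makes its visits. *)
pose r := sort (relpre s leq) (enum 'I_n).
have mem_r i : i \in r by rewrite mem_sort mem_enum.
have s_inj : injective s.
  move=> i j E; apply/eqP/contraT => /gD; rewrite /disjoint_intervals /before.
  have /and3P[_ _] := gP i; have /and3P[_ _] := gP j.
  by rewrite -/(s i) -/(s j) E; lia.
have sorted_r : sorted (fun i j => before (g i) (g j)) r.
  have : sorted ltn (map s r).
    rewrite ltn_sorted_uniq_leq map_inj_uniq // sort_uniq enum_uniq /=.
    by rewrite sorted_map; apply: sort_sorted => i j; apply: leq_total.
  rewrite sorted_map; apply: sub_sorted => i j /= lt_ij.
  have /gD : i != j by apply: contraTneq lt_ij => ->; rewrite ltnn.
  have /and3P[_ _] := gP j; have /and3P[_ _] := gP i; move: lt_ij.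
  by rewrite /disjoint_intervals /before /s; lia.
exists (flatten [seq [:: (star_edge i, (g i).1); (star_edge i, (g i).2)] | i <- r]).
exists (flatten [seq [:: leaf i; center n] | i <- r]); split; last first.
  move=> i; rewrite inE; apply/orP; right; apply/flattenP.
  by exists [:: leaf i; center n]; [apply: map_f | rewrite inE eqxx].
split.
- move=> e t /flattenP[u /mapP[i _ ->]]; rewrite !inE.
  by case/orP=> /eqP[-> ->]; have /and3P[] := gP i.
- elim: r {mem_r sorted_r} => //= i r ->; rewrite eqxx andbT /=.
  by rewrite setUC.
- by elim: r {mem_r sorted_r} => //= i r.
- have lt_g i : (g i).1 < (g i).2 by have /and3P[] := gP i.
  case: r sorted_r {mem_r} => //= i r; rewrite lt_g /=.
  elim: r i => //= j r IH i /andP[gij /IH ->].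
  by rewrite -/(before (g i) (g j)) gij lt_g.
Qed.

(** The truncation makes the bound 4 hold for every [J], so that [star_of] is total; it changes
    nothing on admissible lists. *)
Definition star_times (J : seq (seq nat)) : time_labelling (star (size J)) :=
  fun e => if leaf_of e is Some i then seq_fset tt (take 4 (nth [::] J i)) else fset0.

Lemma star_times_bound J e : #|` @star_times J e| <= 4.
Proof.
rewrite /star_times; case: (leaf_of e) => [i|]; last by rewrite cardfs0.
rewrite size_seq_fset; apply: leq_trans (size_undup _) _.
by rewrite size_take; case: ltnP.
Qed.

Definition star_of (J : seq (seq nat)) : temporal_star 4 :=
  TemporalStar (@star_times_bound J).

(** A strictly increasing list is what [encode_times] gets by sorting its set of times, so it may be
    printed as it stands. *)
Definition admissible (ts : seq nat) : bool := (size ts <= 4) && sorted ltn ts.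

Lemma star_timesE J (i : 'I_(size J)) : size (nth [::] J i) <= 4 ->
  star_times (star_edge i) = seq_fset tt (nth [::] J i).
Proof. by move=> le4; rewrite /star_times leaf_of_star_edge take_oversize. Qed.

Definition encode_job (ts : seq nat) : seq bool :=
  flatten [seq encode_time t | t <- ts] ++ [:: true; true].

Lemma encode_star_of J : all admissible J ->
  encode_star (star_of J) = flatten [seq encode_job ts | ts <- J].
Proof.
move=> adm; rewrite /encode_star /=; congr flatten.
rewrite -[in RHS](mkseq_nth [::] J) /mkseq -val_enum_ord -!map_comp.
apply: eq_map => i /=.
have /andP[le4 srt] := all_nthP [::] adm i (ltn_ord i).
rewrite star_timesE // /encode_times /encode_job; congr (flatten (map _ _) ++ _).
apply: (sorted_eq leq_trans anti_leq).
- exact: sort_sorted leq_total _.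
- by move: srt; rewrite ltn_sorted_uniq_leq => /andP[].
rewrite perm_sort; apply: uniq_perm; first exact: fset_uniq.
  by move: srt; rewrite ltn_sorted_uniq_leq => /andP[].
exact: seq_fsetE.
Qed.

Lemma star_of_explorable (X : eqType) (ids : seq X) (tm : X -> seq nat) :
  uniq ids -> all (admissible \o tm) ids ->
  yes_instance (star_of (map tm ids) : instance (StarExp 4)) <->
  exists g : X -> nat * nat,
    (forall x, x \in ids -> interval_of (tm x) (g x)) /\
    (forall x y, x \in ids -> y \in ids -> x != y -> disjoint_intervals (g x) (g y)).
Proof.
move=> uids adm; set J := map tm ids.
have sJ : size J = size ids by rewrite size_map.
have timesE (i : 'I_(size J)) x0 :
    star_times (star_edge i) = seq_fset tt (tm (nth x0 ids i)).
  have lt_i : i < size ids by rewrite -sJ.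
  rewrite star_timesE (nth_map x0) //.
  by have /andP[] := all_nthP x0 adm i lt_i.
apply: iff_trans (explorable_intervals (@star_times J)) _.
split=> [[g [gP gD]]|[g [gP gD]]].
  pose h x := if insub (index x ids) is Some i then g i else (0, 0).
  have hE x : x \in ids -> exists2 i : 'I_(size J), i = index x ids :> nat & h x = g i.
    rewrite -index_mem -sJ => lt_i; exists (Ordinal lt_i) => //.
    by rewrite /h insubT.
  exists h; split=> [x xI|x y xI yI ne_xy].
    have [i Ei ->] := hE x xI; have := gP i.
    by rewrite (timesE i x) !seq_fsetE Ei nth_index.
  have [i Ei ->] := hE x xI; have [k Ek ->] := hE y yI; apply: gD.
  apply: contra ne_xy => /eqP E.
  by rewrite -(nth_index x xI) -(nth_index x yI) -Ei -Ek E.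
case: (posnP (size ids)) => [s0|ids0].
  by exists (fun=> (0, 0)); split=> i; exfalso; have := ltn_ord i; rewrite [X in _ < X]sJ s0.
have [x0 _] : exists x0 : X, True by case: (ids) ids0 => // x *; exists x.
have lt_i (i : 'I_(size J)) : i < size ids := leq_trans (ltn_ord i) (eq_leq sJ).
have mem_i (i : 'I_(size J)) : nth x0 ids i \in ids by apply: mem_nth.
exists (fun i => g (nth x0 ids i)); split=> [i|i k ne_ik].
  by rewrite (timesE i x0) !seq_fsetE; apply: gP (mem_i i).
by apply: gD => //; rewrite nth_uniq.
Qed.

(** * Clauses as interval selection *)

(* [SV k]: the truth value of variable [k], with a region of time for each of
   the two literals of [k]; [SB k b]: a forced interval at the end of region
   [b]; [SC c]: the choice of a true literal of clause [c]; [SD c]: a forced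
   interval after the times of [c]; [SW c p]: the wire from literal number [p]
   of [c] to the region of that literal. *)
Inductive sid (K : Type) :=
  | SV of K | SB of K & bool | SC of nat | SD of nat | SW of nat & nat.
Arguments SC {K}.
Arguments SD {K}.
Arguments SW {K}.

Definition sid_code K (s : sid K) : K + K * bool + nat + nat + nat * nat :=
  match s with
  | SV k => inl (inl (inl (inl k)))
  | SB k b => inl (inl (inl (inr (k, b))))
  | SC c => inl (inl (inr c))
  | SD c => inl (inr c)
  | SW c p => inr (c, p)
  end.
Definition sid_decode K (x : K + K * bool + nat + nat + nat * nat) : sid K :=
  match x with
  | inl (inl (inl (inl k))) => SV k
  | inl (inl (inl (inr kb))) => SB kb.1 kb.2
  | inl (inl (inr c)) => SC c
  | inl (inr c) => SD c
  | inr cp => SW cp.1 cp.2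
  end.
Lemma sid_codeK K : cancel (@sid_code K) (@sid_decode K). Proof. by case. Qed.
HB.instance Definition _ (K : eqType) :=
  Equality.copy (sid K) (can_type (@sid_codeK K)).

Definition sid_tag K (s : sid K) : nat :=
  match s with SV _ => 0 | SB _ _ => 1 | SC _ => 2 | SD _ => 3 | SW _ _ => 4 end.

Lemma sid_tag_neq (I K : eqType) (x y : I * sid K) :
  sid_tag x.2 != sid_tag y.2 -> x != y.
Proof. by apply: contraNneq => ->. Qed.

Section Schedule.

Variables (I K : eqType) (M : nat).
(** [vok] also covers variables that have no leaf but occur in clauses: wires lead to their regions
    too, so these need distinct numbers. *)
Variables (vjob vok : pred (I * K)) (cjob : pred (I * nat)).
Variables (lit : I * nat -> nat -> (I * K) * bool).
Variables (vnum : I * K -> nat) (cnum : I * nat -> nat).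

Hypothesis M_gt0 : 0 < M.
Hypothesis vnum_gt0 : forall v, 0 < vnum v.
Hypothesis vjob_ok : forall v, vjob v -> vok v.
Hypothesis lit_ok : forall c p, cjob c -> p < 3 -> vok (lit c p).1.
Hypothesis vnum_inj : {in vok &, injective vnum}.
Hypothesis cnum_lt : forall c, cjob c -> cnum c < M.
Hypothesis cnum_inj : {in cjob &, injective cnum}.

(** Mixed-radix numbers. The digits are [u < 16], an offset [o < 8 * M], and in [vtime] the end [m]
    of the region, its literal [b] and its variable. Since [cnum c < M], the summand [M] acts as a
    leading bit when [M] is a power of two, and all times of clauses precede all regions. *)
Definition ctime (c : I * nat) (u : nat) : nat := u + 16 * (cnum c + M).
Definition ltime (u o y : nat) : nat := u + 16 * (o + 8 * M * y).
Definition vtime (v : I * K) (b m : bool) (o u : nat) : nat :=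
  ltime u o (m + 2 * (b + 2 * vnum v)).
(** The place of a wire inside a region; [2 ^ p] is the value of the one-hot code of [p] on three
    bits. *)
Definition slot (c : I * nat) (p : nat) : nat := 2 ^ p + 8 * cnum c.

Definition job_times (x : I * sid K) : seq nat :=
  match x.2 with
  | SV k => let v := (x.1, k) in
      [:: vtime v false false 0 0; vtime v false true 0 0;
          vtime v true false 0 0; vtime v true true 0 0]
  | SB k b => let v := (x.1, k) in [:: vtime v b true 0 1; vtime v b true 0 2]
  | SC c => [seq ctime (x.1, c) u | u <- [:: 0; 2; 5; 8]]
  | SD c => [seq ctime (x.1, c) u | u <- [:: 9; 10]]
  | SW c p => let l := lit (x.1, c) p in
      [:: ctime (x.1, c) (3 * p); ctime (x.1, c) (3 * p + 1);
          vtime l.1 l.2 false (slot (x.1, c) p) 0;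
          vtime l.1 l.2 false (slot (x.1, c) p) 1]
  end.

Definition is_job (x : I * sid K) : bool :=
  match x.2 with
  | SV k | SB k _ => vjob (x.1, k)
  | SC c | SD c => cjob (x.1, c)
  | SW c p => cjob (x.1, c) && (p < 3)
  end.

Lemma ltime_y u o y u' o' y' :
  y < y' -> u < 16 -> o < 8 * M -> ltime u o y < ltime u' o' y'.
Proof. by rewrite /ltime => *; nia. Qed.

Lemma ltime_o u o u' o' y : o < o' -> u < 16 -> ltime u o y < ltime u' o' y.
Proof. by rewrite /ltime => *; lia. Qed.

Lemma ltime_u u u' o y : u < u' -> ltime u o y < ltime u' o y.
Proof. by rewrite /ltime => *; lia. Qed.

Lemma ctime_ltime c u u' o y : cjob c -> u < 16 -> 0 < y -> ctime c u < ltime u' o y.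
Proof. by move/cnum_lt; rewrite /ctime /ltime => *; nia. Qed.

Lemma ctime_u c u u' : (ctime c u < ctime c u') = (u < u').
Proof. by rewrite /ctime ltn_add2r. Qed.

Lemma slot_lt c p : cjob c -> p < 3 -> slot c p < 8 * M.
Proof. by move/cnum_lt; rewrite /slot; case: p => [|[|[|]]] //= *; lia. Qed.

Lemma o0_lt : 0 < 8 * M. Proof. by lia. Qed.

Lemma vtime_y_gt0 v (b m : bool) : 0 < m + 2 * (b + 2 * vnum v).
Proof. by have := vnum_gt0 v; lia. Qed.

Lemma ctime_vtime c u v b m o u' : cjob c -> u < 16 -> ctime c u < vtime v b m o u'.
Proof. by move=> jc lt_u; apply: ctime_ltime => //; apply: vtime_y_gt0. Qed.

Lemma vtime0E v (b m : bool) u :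
  vtime v b m 0 u = u + 128 * (M * m) + 256 * (M * b) + 512 * (M * vnum v).
Proof. by rewrite /vtime /ltime; case: b; case: m => /=; lia. Qed.

Lemma job_times_admissible x : is_job x -> admissible (job_times x).
Proof.
case: x => i [k|k b|c|c|c p]; rewrite /is_job /admissible /= ?andbT.
- move=> _; apply/and3P; split; apply: ltime_y; rewrite ?o0_lt //; lia.
- by move=> _; apply: ltime_u.
- by rewrite !ctime_u.
- by rewrite !ctime_u.
case/andP=> jc lt_p; rewrite ctime_u addn1 ltnSn /=; apply/andP; split.
  by apply: ctime_vtime => //; lia.
exact: ltime_u.
Qed.

Lemma disjoint_ltime u1 o1 y1 u2 o2 y2 u3 o3 y3 u4 o4 y4 :
  (y2 < y3) || (y4 < y1) -> u2 < 16 -> o2 < 8 * M -> u4 < 16 -> o4 < 8 * M ->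
  disjoint_intervals (ltime u1 o1 y1, ltime u2 o2 y2) (ltime u3 o3 y3, ltime u4 o4 y4).
Proof.
move=> lt_y *; apply/orP; case/orP: lt_y => lt_y; [left | right]; exact: ltime_y.
Qed.

Lemma disjoint_ctime_ltime c u1 u2 u3 o3 y3 z : cjob c -> u2 < 16 -> 0 < y3 ->
  disjoint_intervals (ctime c u1, ctime c u2) (ltime u3 o3 y3, z).
Proof. by move=> *; apply/orP; left; apply: ctime_ltime. Qed.

Lemma disjoint_ctime c c' u1 u2 u3 u4 : cjob c -> cjob c' -> c != c' ->
  u1 < 16 -> u2 < 16 -> u3 < 16 -> u4 < 16 ->
  disjoint_intervals (ctime c u1, ctime c u2) (ctime c' u3, ctime c' u4).
Proof.
move=> jc jc' ne *; have : cnum c != cnum c'.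
  by apply: contra ne => /eqP E; apply/eqP; apply: cnum_inj.
by rewrite /disjoint_intervals /before /ctime /=; lia.
Qed.

Lemma disjoint_ctime_same c u1 u2 u3 u4 :
  disjoint_intervals (ctime c u1, ctime c u2) (ctime c u3, ctime c u4)
  = disjoint_intervals (u1, u2) (u3, u4).
Proof. by rewrite /disjoint_intervals /before /= !ctime_u. Qed.

Theorem schedule_satisfiable :
  (exists g : I * sid K -> nat * nat,
     (forall x, is_job x -> interval_of (job_times x) (g x)) /\
     (forall x y, is_job x -> is_job y -> x != y -> disjoint_intervals (g x) (g y)))
  <->
  (exists alpha : I * K -> bool, forall c, cjob c -> exists2 p, p < 3 &
     ~~ vjob (lit c p).1 || (alpha (lit c p).1 == (lit c p).2)).
Proof.
split=> [[g [gP gD]]|[alpha sat]].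
  have gT x y : is_job x -> is_job y -> sid_tag x.2 != sid_tag y.2 ->
      disjoint_intervals (g x) (g y).
    by move=> jx jy /sid_tag_neq; apply: gD.
  pose gV (v : I * K) := g (v.1, SV v.2).
  (* A variable is true when its leaf occupies the region of its negative literal. *)
  exists (fun v => gV v == (vtime v false false 0 0, vtime v false true 0 0)).
  (* Of the six intervals between four times, the four that join the two regions contain the forced
     interval of [SB v.2 false]. *)
  have gVE v : vjob v -> exists b, gV v = (vtime v b false 0 0, vtime v b true 0 0).
    move=> jv.
    have jV : is_job (v.1, SV v.2) by rewrite /is_job /= -surjective_pairing.
    have jB : is_job (v.1, SB v.2 false) by rewrite /is_job /= -surjective_pairing.
    have := gT _ _ jV jB isT; have := gP _ jV; have := gP _ jB.
    rewrite /gV /interval_of /job_times /= -surjective_pairing.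
    case: (g _) => b1 b2; case: (g _) => a1 a2 /=; rewrite !inE.
    have E1 : b1 < b2 -> (b1 == vtime v false true 0 1) || (b1 == vtime v false true 0 2)
      -> (b2 == vtime v false true 0 1) || (b2 == vtime v false true 0 2) ->
      b1 = vtime v false true 0 1 /\ b2 = vtime v false true 0 2.
      by rewrite /vtime /ltime; lia.
    case/and3P=> H1 H2 /E1 /(_ H1 H2)[-> ->] {E1 H1 H2}.
    case/and3P=> H1 H2 lt_a; rewrite /disjoint_intervals /before /= => dis.
    case/or4P: H1 lt_a dis => /eqP->; case/or4P: H2 => /eqP-> lt_a dis;
      first [by exists false | by exists true | exfalso; move: lt_a dis; rewrite !vtime0E /=;
        move: (M * vnum v) => X; lia].
  case=> i c jc.
  (* The gaps of [0, 2, 5, 8] contain [[0, 1]], [[3, 4]] and [[6, 7]] respectively, so any interval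
     of the clause covers the near position of some wire. *)
  have [p lt_p cov] : exists2 p, p < 3 &
      ((g (i, SC c)).1 <= ctime (i, c) (3 * p)) && (ctime (i, c) (3 * p + 1) <= (g (i, SC c)).2).
    have := gP (i, SC c) jc; rewrite /interval_of /job_times /=.
    case: (g _) => a1 a2 /=; rewrite !inE /ctime => /and3P[H1 H2 lt_a].
    have [lt0|ge0] := boolP (a1 == 0 + 16 * (cnum (i, c) + M)); first by exists 0; lia.
    have [lt1|ge1] := boolP (a1 == 2 + 16 * (cnum (i, c) + M)); first by exists 1; lia.
    by exists 2; lia.
  exists p => //; case: (boolP (vjob _)) => //= jv.
  have jW : is_job (i, SW c p) by rewrite /is_job /= jc.
  have jC : is_job (i, SC c) by [].
  have jD : is_job (i, SD c) by [].
  have := gT _ _ jW jC isT; have := gT _ _ jW jD isT.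
  have := gP _ jD; have := gP _ jW.
  rewrite /interval_of /job_times /=; set l := lit _ p in jv *.
  have [b gVb] := gVE l.1 jv.
  have jV : is_job (l.1.1, SV l.1.2) by rewrite /is_job /= -surjective_pairing.
  have := gT _ _ jW jV isT; rewrite -/(gV l.1) gVb.
  case: (g (i, SC c)) cov => a1 a2 /= /andP[le_a1 le_a2].
  case: (g (i, SD c)) => d1 d2 /=; case: (g (i, SW c p)) => w1 w2 /=.
  have lt1 : ctime (i, c) (3 * p) < vtime l.1 l.2 false (slot (i, c) p) 0.
    by apply: ctime_vtime => //; lia.
  have lt2 : ctime (i, c) 10 < vtime l.1 l.2 false (slot (i, c) p) 0.
    by apply: ctime_vtime.
  have lt3 : vtime l.1 l.2 false (slot (i, c) p) 0 < vtime l.1 l.2 false (slot (i, c) p) 1.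
    exact: ltime_u.
  rewrite !inE /disjoint_intervals /before /= => dV /and3P[W1 W2 ltW] /and3P[D1 D2 ltD] dD dC.
  (* The near position of the wire is taken by the clause, and an interval from there to the region
     would contain that of [SD c]; only the far position is left. *)
  have Ew : w1 = vtime l.1 l.2 false (slot (i, c) p) 0 /\
            w2 = vtime l.1 l.2 false (slot (i, c) p) 1.
    move: le_a1 le_a2 lt1 lt2 lt3 W1 W2 ltW D1 D2 ltD dD dC {dV}; rewrite /ctime.
    by move: (vtime _ _ _ _ 0) (vtime _ _ _ _ 1) => x y; lia.
  case: Ew dV => -> -> dV.
  (* The far position lies inside region [l.2], so the leaf of the variable must be in the other
     one. *)
  have : b != l.2.
    apply: contraTneq dV => ->; rewrite negb_or -!leqNgt; apply/andP; split.
      by rewrite /vtime /ltime; lia.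
    have lt_s := slot_lt jc lt_p.
    by apply/ltnW/ltime_y => //; lia.
  by case: (b) (l.2) => -[] // _; rewrite xpair_eqE /vtime /ltime; nia.
(* Just one wire leaves each clause, that of a chosen true literal; the others stay at [3 * p], in
   gaps that the clause does not use. *)
pose ch c := if [pick p : 'I_3 |
  ~~ vjob (lit c p).1 || (alpha (lit c p).1 == (lit c p).2)] is Some p
  then p : nat else 0.
have chP c : cjob c -> ch c < 3 /\
    (vjob (lit c (ch c)).1 -> alpha (lit c (ch c)).1 = (lit c (ch c)).2).
  move=> jc; rewrite /ch; case: pickP => [p|no].
    by move=> H; split=> // jv; move: H; rewrite jv => /eqP.
  by have [p lt_p] := sat c jc; rewrite (no (Ordinal lt_p)).
pose g (x : I * sid K) := match x.2 with
  | SV k => let v := (x.1, k) in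
      (vtime v (~~ alpha v) false 0 0, vtime v (~~ alpha v) true 0 0)
  | SB k b => let v := (x.1, k) in (vtime v b true 0 1, vtime v b true 0 2)
  | SC c => let c' := (x.1, c) in
      (ctime c' (nth 0 [:: 0; 2; 5] (ch c')), ctime c' (nth 0 [:: 2; 5; 8] (ch c')))
  | SD c => (ctime (x.1, c) 9, ctime (x.1, c) 10)
  | SW c p => let c' := (x.1, c) in let l := lit c' p in
      if p == ch c' then (vtime l.1 l.2 false (slot c' p) 0, vtime l.1 l.2 false (slot c' p) 1)
      else (ctime c' (3 * p), ctime c' (3 * p + 1))
  end.
exists g; split.
  case=> i [k|k b|c|c|c p]; rewrite /is_job /interval_of /job_times /g /=.
  - move=> _; have lt_v b : vtime (i, k) b false 0 0 < vtime (i, k) b true 0 0.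
      by apply: ltime_y; rewrite ?o0_lt //; lia.
    by rewrite lt_v; case: (alpha _); rewrite !inE !eqxx ?orbT.
  - by move=> _; rewrite !inE !eqxx !orbT /=; apply: ltime_u.
  - move=> jc; have [lt_ch _] := chP _ jc.
    by case: (ch _) lt_ch => [|[|[|]]] //= _; rewrite !inE !eqxx ?orbT ctime_u.
  - by move=> jc; rewrite !inE !eqxx ?orbT ctime_u.
  - move=> _; case: ifP => _ /=; rewrite !inE !eqxx ?orbT /=; first exact: ltime_u.
    by rewrite ctime_u; lia.
have vne v v' : vok v -> vok v' -> v != v' -> vnum v != vnum v'.
  by move=> ok ok' ne; apply: contra ne => /eqP E; apply/eqP; apply: vnum_inj.
have vdec v v' : vok v -> vok v' -> v = v' \/ vnum v != vnum v'.
  by move=> ok ok'; case: (eqVneq v v') => [|ne]; [left | right; apply: vne].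
have chok i c : cjob (i, c) -> nth 0 [:: 0; 2; 5] (ch (i, c)) < 16 /\
    nth 0 [:: 2; 5; 8] (ch (i, c)) < 16.
  by move/chP => [lt_ch _]; case: (ch _) lt_ch => [|[|[|]]].
(* By symmetry 15 of the 25 pairs of leaf types suffice. *)
suff H x y : sid_tag x.2 <= sid_tag y.2 -> is_job x -> is_job y -> x != y ->
    disjoint_intervals (g x) (g y).
  move=> x y jx jy ne; case: (leqP (sid_tag x.2) (sid_tag y.2)) => le_t; first exact: H.
  by rewrite disjoint_intervals_sym; apply: H => //; [apply: ltnW | rewrite eq_sym].
have cv c u1 u2 v b m o u z : cjob c -> u2 < 16 ->
    disjoint_intervals (ctime c u1, ctime c u2) (vtime v b m o u, z).
  by move=> jc lt_u; apply: disjoint_ctime_ltime => //; apply: vtime_y_gt0.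
have wire_ok i c p : cjob (i, c) -> p < 3 ->
    [/\ vok (lit (i, c) p).1, slot (i, c) p < 8 * M, 3 * p < 16 & 3 * p + 1 < 16].
  by move=> jc lt_p; rewrite lit_ok // slot_lt //; split=> //; lia.
have region v (b m1 m2 : bool) o1 u1 o2 u2 v' (b' m3 m4 : bool) o3 u3 o4 u4 :
    (vnum v != vnum v') || (b != b') -> u2 < 16 -> o2 < 8 * M -> u4 < 16 -> o4 < 8 * M ->
    disjoint_intervals (vtime v b m1 o1 u1, vtime v b m2 o2 u2)
      (vtime v' b' m3 o3 u3, vtime v' b' m4 o4 u4).
  move=> ne *; apply: disjoint_ltime => //; move: ne.
  by case: (b) (b') (m1) (m2) (m3) (m4) => [] [] [] [] [] [] //=; lia.
case: x => i [k|k b|c|c|c p]; case: y => j [k'|k' b'|c'|c'|c' p'] //= _;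
  rewrite /is_job /g /=.
- move=> jx jy ne; apply: region;
    rewrite ?o0_lt //.
  by case: (vdec _ _ (vjob_ok jx) (vjob_ok jy)) => [E|-> //]; case: E ne => -> ->; rewrite eqxx.
- move=> jx jy _; case: (vdec _ _ (vjob_ok jx) (vjob_ok jy)) => [[<- <-]|ne].
    case: (eqVneq b' (~~ alpha (i, k))) => [->|neb].
      by apply/orP; left; apply: ltime_u.
    apply: region;
      by rewrite ?o0_lt // eq_sym neb orbT.
  apply: region;
    by rewrite ?o0_lt // ne.
- by move=> jx jy _; rewrite disjoint_intervals_sym; apply: cv => //; have [] := chok _ _ jy.
- by move=> jx jy _; rewrite disjoint_intervals_sym; apply: cv.
- move=> jx /andP[jy lt_p] _; have [okl lt_s lt1 lt2] := wire_ok _ _ _ jy lt_p.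
  case: eqP => [Ep|_]; last by rewrite disjoint_intervals_sym; apply: cv.
  apply: region;
    rewrite ?o0_lt //.
  case: (vdec _ _ (vjob_ok jx) okl) => [E|-> //].
  have [_] := chP _ jy; rewrite -Ep -E => /(_ jx) <-.
  by case: (alpha _); rewrite orbT.
- move=> jx jy ne; apply: region;
    rewrite ?o0_lt //.
  case: (vdec _ _ (vjob_ok jx) (vjob_ok jy)) => [E|-> //]; case: E ne => -> -> ne.
  by apply/orP; right; apply: contra ne => /eqP ->.
- by move=> jx jy _; rewrite disjoint_intervals_sym; apply: cv => //; have [] := chok _ _ jy.
- by move=> jx jy _; rewrite disjoint_intervals_sym; apply: cv.
- move=> jx /andP[jy lt_p] _; have [okl lt_s lt1 lt2] := wire_ok _ _ _ jy lt_p.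
  case: eqP => [Ep|_]; last by rewrite disjoint_intervals_sym; apply: cv.
  apply: disjoint_ltime; rewrite ?o0_lt //.
  case: (vdec _ _ (vjob_ok jx) okl) => [->|].
    by case: (b) (lit _ _).2 => -[] /=; lia.
  by case: (b) (lit _ _).2 => -[] /=; lia.
- move=> jx jy ne; have [lt1 lt2] := chok _ _ jx; have [lt3 lt4] := chok _ _ jy.
  exact: disjoint_ctime.
- move=> jx jy _; have [lt1 lt2] := chok _ _ jx.
  case: (eqVneq (i, c) (j, c')) => [<-|ne]; last exact: disjoint_ctime.
  rewrite disjoint_ctime_same; have [lt_ch _] := chP _ jx.
  by case: (ch _) lt_ch => [|[|[|]]].
- move=> jx /andP[jy lt_p] _; have [okl lt_s lt3 lt4] := wire_ok _ _ _ jy lt_p.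
  have [lt1 lt2] := chok _ _ jx.
  case: eqP => [Ep|nep]; first exact: cv.
  case: (eqVneq (i, c) (j, c')) => [E|ne]; last exact: disjoint_ctime.
  move: nep; rewrite -E disjoint_ctime_same; have [lt_ch _] := chP _ jx.
  by case: (ch _) lt_ch => [|[|[|]]] //; case: (p') lt_p => [|[|[|]]].
- move=> jx jy ne; exact: disjoint_ctime.
- move=> jx /andP[jy lt_p] _; have [okl lt_s lt3 lt4] := wire_ok _ _ _ jy lt_p.
  case: eqP => [Ep|nep]; first exact: cv.
  case: (eqVneq (i, c) (j, c')) => [E|ne]; last exact: disjoint_ctime.
  by rewrite -E disjoint_ctime_same; case: (p') lt_p => [|[|[|]]].
move=> /andP[jx lt_p] /andP[jy lt_p'] ne.
have [okl lt_s lt3 lt4] := wire_ok _ _ _ jx lt_p.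
have [okl' lt_s' lt3' lt4'] := wire_ok _ _ _ jy lt_p'.
case: eqP => [Ep|nep]; case: eqP => [Ep'|nep'].
(* Two wires that are both in regions come from different clauses, since each clause releases one;
   their slots then differ even within a common region. *)
- have nec : (i, c) != (j, c').
    apply: contra ne => /eqP E; move: Ep Ep'; rewrite E => -> ->.
    by case: E => -> ->.
  have nen : cnum (i, c) != cnum (j, c').
    by apply: contra nec => /eqP E; apply/eqP; apply: cnum_inj.
  have nes : slot (i, c) p != slot (j, c') p'.
    apply: contra nen; rewrite /slot.
    have pow q : q < 3 -> 2 ^ q = 1 \/ 2 ^ q = 2 \/ 2 ^ q = 4.
      by case: q => [|[|[|q]]] //= _; auto.
    by have := pow _ lt_p; have := pow _ lt_p'; lia.
  set l := lit _ _ in okl *; set l' := lit _ _ in okl' *.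
  have [same|diff] := boolP ((vnum l.1 == vnum l'.1) && (l.2 == l'.2)).
    case/andP: same => /eqP Ev /eqP Eb; rewrite /vtime Ev Eb.
    apply/orP; rewrite /before /=.
    by case: (ltngtP (slot _ p)) nes => // lt_o _; [left | right]; apply: ltime_o.
  apply: region => //.
  by rewrite -negb_and.
- exact: (etrans (disjoint_intervals_sym _ _) (cv _ _ _ _ _ _ _ _ _ jy lt4')).
- exact: cv.
case: (eqVneq (i, c) (j, c')) => [E|nec]; last exact: disjoint_ctime.
rewrite -E disjoint_ctime_same.
have : p != p' by apply: contra ne => /eqP ->; case: E => -> ->.
by case: (p) lt_p => [|[|[|]]] // _; case: (p') lt_p' => [|[|[|]]].
Qed.

End Schedule.

(** * Numbers as bit strings *)

Definition bval (s : seq bool) : nat := foldr (fun (b : bool) n => b + 2 * n) 0 s.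

Lemma bval_cat s1 s2 : bval (s1 ++ s2) = bval s1 + 2 ^ size s1 * bval s2.
Proof. by elim: s1 => [|b s IH] /=; rewrite ?expnS ?mul1n // IH; lia. Qed.

Lemma bval_lt s : bval s < 2 ^ size s.
Proof. by elim: s => //= b s IH; rewrite expnS; case: b => /=; lia. Qed.

Lemma bval_nseq0 n : bval (nseq n false) = 0.
Proof. by elim: n => //= n ->. Qed.

Lemma bval_inj s s' : size s = size s' -> bval s = bval s' -> s = s'.
Proof.
elim: s s' => [|b s IH] [|b' s'] //= [/IH H] E.
have Eb : b = b' by move: E; case: (b) (b') => -[] //=; lia.
by rewrite Eb (H _) //; move: E; rewrite Eb; lia.
Qed.

Lemma bval_div s k : odd (bval s %/ 2 ^ k) = nth false s k.
Proof.
elim: s k => [|b s IH] k /=; first by rewrite div0n nth_nil.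
case: k => [|k] /=; first by rewrite expn0 divn1 oddD mul2n odd_double addbF; case: b.
rewrite expnS divnMA; have -> : (b + 2 * bval s) %/ 2 = bval s.
  by rewrite addnC mulnC divnMDl // divn_small ?addn0 //; case: b.
exact: IH.
Qed.

(** The hypothesis says that the most significant bit is 1, which excludes leading zeros; for this
    reason the pieces of every time end with [Cst [:: true]]. *)
Lemma binary_bval s : last false s -> binary (bval s) = s.
Proof.
case/lastP: s => // s b; rewrite last_rcons => bT; rewrite /binary {b}bT.
have -> : up_log 2 (bval (rcons s true)).+1 = (size s).+1.
  apply: up_log_eq => //; apply/andP; split.
    by rewrite -cats1 bval_cat /=; lia.
  by have := bval_lt (rcons s true); rewrite size_rcons.
rewrite -(size_rcons s true); apply: (@eq_from_nth _ false).
  by rewrite size_map size_iota.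
move=> i; rewrite size_map size_iota => lt_i.
by rewrite (nth_map 0) ?size_iota // nth_iota // bval_div.
Qed.

Lemma encode_job_bval ss : all (last false) ss ->
  encode_job (map bval ss) = encode_bits_job ss.
Proof.
move=> /allP H; rewrite /encode_job /encode_bits_job -map_comp; congr (flatten _ ++ _).
by apply/eq_in_map => s /H /binary_bval E; rewrite /= /encode_time E.
Qed.

Definition bits4 (u : nat) : seq bool := mkseq (fun i => odd (u %/ 2 ^ i)) 4.

Lemma bval_bits4 u : u < 16 -> bval (bits4 u) = u.
Proof. by do 16 (case: u => [//|u]). Qed.

Lemma size_onehot W x : size (onehot W x) = W.
Proof. exact: size_mkseq. Qed.

Lemma bval_onehot W x : x < W -> bval (onehot W x) = 2 ^ x.
Proof.
by move=> lt_x; rewrite onehotE // bval_cat size_nseq /= !bval_nseq0 muln1.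
Qed.

Lemma onehot_inj W x y : x < W -> y < W -> onehot W x = onehot W y -> x = y.
Proof.
move=> lt_x lt_y E; have := nth_mkseq false (fun u => u == x) lt_x.
by rewrite -/(onehot W x) E nth_mkseq // eqxx => /eqP.
Qed.

Lemma onehot_cat_inj W x y s s' : x < W -> y < W ->
  onehot W x ++ s = onehot W y ++ s' -> x = y /\ s = s'.
Proof.
move=> lt_x lt_y /eqP; rewrite eqseq_cat ?size_onehot // => /andP[/eqP E /eqP ->].
by split=> //; apply: onehot_inj E.
Qed.

(** * Templates of formulas *)

(* A literal of the clause at [(t, j)] is a variable at shifted or fixed
   indices; variables outside the square [N x N] are unconstrained. *)
Definition apply_mode (m : mode) (v : nat) : nat :=
  match m with Off a => a + v | Const a => a end.
Definition mode_ok (m : mode) : bool :=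
  match m with Off a => a <= 2 | Const a => a < 2 end.

(** Every field has [N.+2] bits, so that an index below [N] can be shifted by up to 2: the shift is
    the number of padding zeros put in front. *)
Lemma piece_bits_Fld N t j i m : mode_ok m -> index_of i t j < N ->
  piece_bits N t j (Fld i m) = onehot N.+2 (apply_mode m (index_of i t j)).
Proof.
case: m => a /= ok lt_v.
  rewrite !onehotE; try lia.
  rewrite -catA /= catA -nseqD; congr (_ ++ _ :: _).
  by rewrite -nseqD; congr nseq; lia.
rewrite onehotE; last by lia.
by case: a ok => [|[|a]] //= _; rewrite !subSS subn0.
Qed.

Record tlit (K : Type) := TLit { lsign : bool; ltmode : mode; ljmode : mode; lkind : K }.

Definition clause K := (tlit K * tlit K * tlit K)%type.
Definition clause_lit K (c : clause K) (p : nat) : tlit K :=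
  match p with 0 => c.1.1 | 1 => c.1.2 | _ => c.2 end.
Definition template K := seq (option (option bool) * clause K).

Definition tlit_ok K (l : tlit K) : bool := mode_ok (ltmode l) && mode_ok (ljmode l).
Definition clause_ok K (c : clause K) : bool :=
  [&& tlit_ok c.1.1, tlit_ok c.1.2 & tlit_ok c.2].

Definition lit_var K (t j : nat) (l : tlit K) : (nat * nat) * K :=
  ((apply_mode (ltmode l) t, apply_mode (ljmode l) j), lkind l).

Definition in_range K (N : nat) (v : (nat * nat) * K) : bool :=
  (v.1.1 < N) && (v.1.2 < N).

Definition lit_holds K (N : nat) (alpha : (nat * nat) * K -> bool) t j (l : tlit K) :=
  ~~ in_range N (lit_var t j l) || (alpha (lit_var t j l) == lsign l).

Definition template_sat K (tl : template K) (w : seq bool) (N : nat)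
    (alpha : (nat * nat) * K -> bool) : Prop :=
  forall t j, t < N -> j < N -> all (fun gc => active w t j gc.1 ==>
    [|| lit_holds N alpha t j gc.2.1.1, lit_holds N alpha t j gc.2.1.2
      | lit_holds N alpha t j gc.2.2]) tl.

(** * The star of a template and its encoding *)

Section Concrete.

Variables (K : finType) (tl : template K) (d0 : option (option bool) * clause K).

Let gc (c : nat) := nth d0 tl c.

Definition kbits (k : K) : seq bool := onehot #|K| (enum_rank k).

Definition cpieces (c : nat) : seq piece :=
  [:: Cst (onehot (size tl) c); Fld false (Off 0); Fld true (Off 0)].
Definition vpieces (l : tlit K) : seq piece :=
  [:: Cst (kbits (lkind l)); Fld false (ljmode l); Fld true (ltmode l); Cst [:: true]].
(** The offset 0, padded to the length of a slot so that the higher digits are aligned. *)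
Definition zero_pieces : seq piece :=
  [:: Cst (nseq 3 false); Cst (nseq (size tl) false); Nul false; Nul true].
Definition slot_pieces (c p : nat) : seq piece := Cst (onehot 3 p) :: cpieces c.

Definition ctime_pieces (c u : nat) : seq piece :=
  Cst (bits4 u) :: cpieces c ++ [:: Cst [:: true]].
Definition vtime_pieces (l : tlit K) (b m : bool) (o : seq piece) (u : nat) : seq piece :=
  Cst (bits4 u) :: o ++ Cst [:: m; b] :: vpieces l.

Definition job_pieces (s : sid K) : seq (seq piece) :=
  match s with
  | SV k => let l := TLit true (Off 0) (Off 0) k in
      [:: vtime_pieces l false false zero_pieces 0; vtime_pieces l false true zero_pieces 0;
          vtime_pieces l true false zero_pieces 0; vtime_pieces l true true zero_pieces 0]
  | SB k b => let l := TLit true (Off 0) (Off 0) k in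
      [:: vtime_pieces l b true zero_pieces 1; vtime_pieces l b true zero_pieces 2]
  | SC c => [seq ctime_pieces c u | u <- [:: 0; 2; 5; 8]]
  | SD c => [seq ctime_pieces c u | u <- [:: 9; 10]]
  | SW c p => let l := clause_lit (gc c).2 p in
      [:: ctime_pieces c (3 * p); ctime_pieces c (3 * p + 1);
          vtime_pieces l (lsign l) false (slot_pieces c p) 0;
          vtime_pieces l (lsign l) false (slot_pieces c p) 1]
  end.

Definition job_guard (s : sid K) : option (option bool) :=
  match s with SV _ | SB _ _ => None | SC c | SD c | SW c _ => (gc c).1 end.

Definition job_list : seq (sid K) :=
  [seq SV k | k <- enum K] ++ [seq SB k b | k <- enum K, b <- [:: false; true]] ++
  [seq SC c | c <- iota 0 (size tl)] ++ [seq SD c | c <- iota 0 (size tl)] ++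
  [seq SW c p | c <- iota 0 (size tl), p <- iota 0 3].

Lemma mem_job_list s : (s \in job_list) =
  match s with
  | SV _ | SB _ _ => true
  | SC c | SD c => c < size tl
  | SW c p => (c < size tl) && (p < 3)
  end.
Proof.
rewrite /job_list !mem_cat.
have SVi : injective (@SV K) by move=> x y [].
have SCi : injective (@SC K) by move=> x y [].
have SDi : injective (@SD K) by move=> x y [].
have no X (f : X -> sid K) (xs : seq X) : (forall x, sid_tag (f x) != sid_tag s) ->
    s \in map f xs = false.
  by move=> ne; elim: xs => //= x xs IH; rewrite inE IH orbF; apply: contraNF (ne x) => /eqP->.
have no2 X Y (f : X -> Y -> sid K) (xs : seq X) (ys : seq Y) :
    (forall x y, sid_tag (f x y) != sid_tag s) ->
    s \in [seq f x y | x <- xs, y <- ys] = false.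
  move=> ne; elim: xs => //= x xs IH; rewrite mem_cat IH orbF.
  by elim: ys {IH} => //= y ys IH; rewrite inE IH orbF; apply: contraNF (ne x y) => /eqP->.
case: s no no2 => [k|k b|c|c|c p] no no2.
- by rewrite mem_map // mem_enum.
- rewrite no // (_ : _ \in allpairs _ _ _ = true) //.
  by apply/allpairsP; exists (k, b); rewrite mem_enum; split=> //; case: (b).
- by rewrite no // no2 // mem_map // mem_iota no // no2 // !orbF.
- by rewrite no // no2 // no // mem_map // mem_iota no2 // !orbF.
rewrite no // no2 // no // no // !orFb; apply/allpairsP/andP => [[[c' p'] [h1 h2 [-> ->]]]|[h1 h2]].
  by move: h1 h2; rewrite !mem_iota !add0n.
by exists (c, p); rewrite !mem_iota !add0n.
Qed.

Lemma job_list_uniq : uniq job_list.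
Proof.
have ucat n (s1 s2 : seq (sid K)) : uniq s1 -> uniq s2 ->
    {in s1, forall x, sid_tag x = n} -> {in s2, forall x, n < sid_tag x} -> uniq (s1 ++ s2).
  move=> u1 u2 t1 t2; rewrite cat_uniq u1 u2 andbT /=.
  by apply/hasPn => x /t2 lt_n; apply/negP => /t1 E; rewrite E ltnn in lt_n.
have umap (X : eqType) (f : X -> sid K) (s : seq X) : injective f -> uniq s -> uniq (map f s).
  by move=> /map_inj_uniq ->.
have uiota := iota_uniq 0 (size tl).
apply: (ucat 0); [by apply: umap (enum_uniq _) => ? ? [] | | by move=> x /mapP[? _ ->] |].
  apply: (ucat 1); [| | by move=> x /allpairsP[[? ?] [_ _ ->]] |].
    by apply: allpairs_uniq; rewrite ?enum_uniq // => -[? ?] [? ?] _ _ [-> ->].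
    apply: (ucat 2); [by apply: umap uiota => ? ? [] | | by move=> x /mapP[? _ ->] |].
      apply: (ucat 3); [by apply: umap uiota => ? ? [] | | by move=> x /mapP[? _ ->] |].
        by apply: allpairs_uniq; rewrite ?iota_uniq // => -[? ?] [? ?] _ _ [-> ->].
      by move=> x /allpairsP[[? ?] [_ _ ->]].
    by move=> x; rewrite mem_cat => /orP[/mapP[? _ ->]|/allpairsP[[? ?] [_ _ ->]]].
  by move=> x; rewrite !mem_cat => /or3P[/mapP[? _ ->]|/mapP[? _ ->]|/allpairsP[[? ?] [_ _ ->]]].
move=> x; rewrite !mem_cat => /or4P[|||]; try by case/mapP => ? _ ->.
all: by case/allpairsP => -[? ?] [_ _ ->].
Qed.

Section Indices.

Variables (w : seq bool) (N : nat).
Hypothesis N_gt0 : 0 < N.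
Hypothesis tl_ok : all (fun gc => clause_ok gc.2) tl.

Definition cbits (x : (nat * nat) * nat) : seq bool :=
  onehot (size tl) x.2 ++ onehot N.+2 x.1.2 ++ onehot N.+2 x.1.1.
Definition vbits (v : (nat * nat) * K) : seq bool :=
  kbits v.2 ++ onehot N.+2 v.1.2 ++ onehot N.+2 v.1.1 ++ [:: true].

(** As a power of two, this value of [M] turns the arithmetic of [ltime] into concatenation of bit
    strings. *)
Definition code_bound : nat := 2 ^ (size tl + (N.+2 + N.+2)).

Definition clause_active (x : (nat * nat) * nat) : bool :=
  [&& in_range N x, x.2 < size tl & active w x.1.1 x.1.2 (gc x.2).1].

Definition clause_var (x : (nat * nat) * nat) (p : nat) : ((nat * nat) * K) * bool :=
  let l := clause_lit (gc x.2).2 p in (lit_var x.1.1 x.1.2 l, lsign l).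

Definition vnum (v : (nat * nat) * K) : nat := bval (vbits v).
Definition cnum (x : (nat * nat) * nat) : nat := bval (cbits x).

Definition times_of := @job_times _ K code_bound clause_var vnum cnum.
Definition is_job_at := @is_job (nat * nat)%type K (in_range N) clause_active.

Definition job_ids : seq ((nat * nat) * sid K) :=
  [seq x <- [seq (tj, s) | tj <- [seq (t, j) | t <- iota 0 N, j <- iota 0 N],
                           s <- job_list]
   | active w x.1.1 x.1.2 (job_guard x.2)].

Lemma mem_job_ids x : (x \in job_ids) = is_job_at x.
Proof.
rewrite mem_filter; case: x => -[t j] s /=.
have -> : ((t, j, s) \in [seq (tj, s0) | tj <- [seq (t0, j0) | t0 <- iota 0 N, j0 <- iota 0 N],
    s0 <- job_list]) = [&& t < N, j < N & s \in job_list].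
  apply/allpairsP/and3P => [[[tj s'] [/= /allpairsP[[t' j'] [/= h1 h2 ->]] h3 [-> -> ->]]]|[h1 h2 h3]].
    by move: h1 h2; rewrite !mem_iota !add0n.
  exists ((t, j), s); split=> //=; apply/allpairsP; exists (t, j).
  by rewrite !mem_iota !add0n.
rewrite mem_job_list /is_job_at /is_job /clause_active /in_range /=.
by case: s => [k|k b|c|c|c p] /=; case: (t < N); case: (j < N); rewrite ?andbF ?andbT //;
  case: (c < size tl) => //; case: (active _ _ _ _) => //=.
Qed.

Lemma job_ids_uniq : uniq job_ids.
Proof.
apply/filter_uniq/allpairs_uniq; [|exact: job_list_uniq|by move=> [? ?] [? ?] _ _ [-> ->]].
by apply: allpairs_uniq; rewrite ?iota_uniq // => -[? ?] [? ?] _ _ [-> ->].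
Qed.

Lemma size_cbits x : size (cbits x) = size tl + (N.+2 + N.+2).
Proof. by rewrite !size_cat !size_onehot. Qed.


Local Arguments time_bits : simpl never.
Local Arguments bval : simpl never.

Lemma clause_lit_ok c p : c < size tl -> tlit_ok (clause_lit (gc c).2 p).
Proof.
move=> lt_c; have /and3P[ok0 ok1 ok2] := all_nthP d0 tl_ok c lt_c.
by case: p => [|[|p]].
Qed.

Lemma time_bits_cons n t j p ps :
  time_bits n t j (p :: ps) = piece_bits n t j p ++ time_bits n t j ps.
Proof. by []. Qed.

Lemma time_bits_cat n t j ps ps' :
  time_bits n t j (ps ++ ps') = time_bits n t j ps ++ time_bits n t j ps'.
Proof. by rewrite /time_bits map_cat flatten_cat. Qed.

Section At.

Variables (t j : nat).
Hypotheses (lt_t : t < N) (lt_j : j < N).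

Let tb := time_bits N t j.

Lemma cpieces_bits c : tb (cpieces c) = cbits ((t, j), c).
Proof. by rewrite /tb !time_bits_cons !piece_bits_Fld // cats0. Qed.

Lemma vpieces_bits l : tlit_ok l -> tb (vpieces l) = vbits (lit_var t j l).
Proof.
by case/andP=> okt okj; rewrite /tb !time_bits_cons !piece_bits_Fld.
Qed.

Lemma ctime_bits c u :
  tb (ctime_pieces c u) = bits4 u ++ cbits ((t, j), c) ++ [:: true].
Proof. by rewrite /tb time_bits_cons time_bits_cat -/tb cpieces_bits. Qed.

Lemma vtime_bits l b m o u : tlit_ok l ->
  tb (vtime_pieces l b m o u) =
  bits4 u ++ tb o ++ [:: m; b] ++ vbits (lit_var t j l).
Proof.
move=> okl.
by rewrite /tb time_bits_cons time_bits_cat time_bits_cons -/tb vpieces_bits.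
Qed.

Lemma bval_ctime c u : u < 16 ->
  bval (tb (ctime_pieces c u)) = ctime code_bound cnum ((t, j), c) u.
Proof.
move=> lt_u; rewrite ctime_bits bval_cat bval_bits4 // size_mkseq bval_cat size_cbits.
by rewrite -/(cnum _) (_ : bval [:: true] = 1) // muln1.
Qed.

Lemma bval_vtime l b m o u : u < 16 -> tlit_ok l ->
  size (tb o) = 3 + (size tl + (N.+2 + N.+2)) ->
  bval (tb (vtime_pieces l b m o u)) =
  vtime code_bound vnum (lit_var t j l) b m (bval (tb o)) u.
Proof.
move=> lt_u okl so; rewrite vtime_bits // bval_cat bval_bits4 // size_mkseq.
by rewrite bval_cat so expnD.
Qed.

Lemma zero_bits : tb zero_pieces = nseq (3 + (size tl + (N.+2 + N.+2))) false.
Proof.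
rewrite /tb !time_bits_cons /piece_bits cats0 -!nseqD.
by congr nseq; lia.
Qed.

Lemma slot_bits c p : tb (slot_pieces c p) = onehot 3 p ++ cbits ((t, j), c).
Proof. by rewrite /tb time_bits_cons -/tb cpieces_bits. Qed.

Lemma job_pieces_times s : is_job_at ((t, j), s) ->
  map bval (map tb (job_pieces s)) = times_of ((t, j), s).
Proof.
have zs : size (tb zero_pieces) = 3 + (size tl + (N.+2 + N.+2)).
  by rewrite zero_bits size_nseq.
have z0 : bval (tb zero_pieces) = 0 by rewrite zero_bits bval_nseq0.
rewrite /is_job_at /is_job /times_of /job_times /job_pieces /=.
case: s => [k|k b|c|c|c p] /= job.
- by rewrite !bval_vtime ?z0.
- by rewrite !bval_vtime ?z0.
- by rewrite !bval_ctime.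
- by rewrite !bval_ctime.
case/andP: job => /and3P[_ lt_c _] lt_p.
have ss : size (tb (slot_pieces c p)) = 3 + (size tl + (N.+2 + N.+2)).
  by rewrite slot_bits size_cat size_onehot size_cbits.
have s0 : bval (tb (slot_pieces c p)) = slot cnum ((t, j), c) p.
  by rewrite slot_bits bval_cat bval_onehot // size_onehot.
by rewrite !bval_vtime ?clause_lit_ok // !s0 !bval_ctime //; lia.
Qed.

Lemma job_pieces_last s : is_job_at ((t, j), s) ->
  all (last false) (map tb (job_pieces s)).
Proof.
have lc c u : last false (tb (ctime_pieces c u)).
  by rewrite ctime_bits !last_cat.
have lv l b m o u : tlit_ok l -> last false (tb (vtime_pieces l b m o u)).
  by move=> okl; rewrite vtime_bits // /vbits !last_cat.
case: s => [k|k b|c|c|c p] job; cbn [all map job_pieces]; rewrite ?lc ?lv //.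
all: by case/andP: job => /and3P[_ lt_c _] lt_p; apply: clause_lit_ok.
Qed.

End At.

(** The variables that clauses at [t, j < N] can reach with shifts up to 2. *)
Definition var_ok (v : (nat * nat) * K) : bool := (v.1.1 < N.+2) && (v.1.2 < N.+2).

Lemma vnum_inj : {in var_ok &, injective vnum}.
Proof.
move=> [[t j] k] [[t' j'] k'] /andP[/= h1 h2] /andP[/= h3 h4] E.
have : vbits ((t, j), k) = vbits ((t', j'), k').
  by apply: bval_inj => //; rewrite !size_cat !size_onehot.
case/(onehot_cat_inj (ltn_ord _) (ltn_ord _)) => /val_inj/enum_rank_inj /= ->.
by case/(onehot_cat_inj h2 h4) => /= -> /(onehot_cat_inj h1 h3)[/= ->].
Qed.

Lemma cnum_inj : {in clause_active &, injective cnum}.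
Proof.
move=> [[t j] c] [[t' j'] c'] /and3P[/andP[/= h1 h2] hc _] /and3P[/andP[/= h3 h4] hc' _] E.
have : cbits ((t, j), c) = cbits ((t', j'), c').
  by apply: bval_inj => //; rewrite !size_cbits.
have lt2 x : x < N -> x < N.+2 by move=> lt_x; rewrite ltnW // ltnW.
case/(onehot_cat_inj hc hc') => /= ->.
case/(onehot_cat_inj (lt2 _ h2) (lt2 _ h4)) => /= ->.
by move/(onehot_inj (lt2 _ h1) (lt2 _ h3)) => ->.
Qed.

Lemma vnum_gt0 v : 0 < vnum v.
Proof.
by rewrite /vnum /vbits !catA bval_cat; apply: ltn_addl; rewrite muln_gt0 expn_gt0.
Qed.

Lemma cnum_lt x : cnum x < code_bound.
Proof. by have := bval_lt (cbits x); rewrite size_cbits. Qed.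

Lemma clause_var_ok x p : clause_active x -> p < 3 -> var_ok (clause_var x p).1.
Proof.
case: x => [[t j] c] /and3P[/andP[/= h1 h2] hc _] _.
have /andP[] := clause_lit_ok p hc; rewrite /var_ok /= /clause_var /lit_var /=.
by case: (ltmode _) => a /= ha; case: (ljmode _) => b /= hb; apply/andP; split; lia.
Qed.

Lemma in_range_ok v : in_range N v -> var_ok v.
Proof. by case/andP=> h1 h2; apply/andP; split; rewrite ltnW // ltnW. Qed.

Lemma job_ids_admissible : all (admissible \o times_of) job_ids.
Proof.
apply/allP => x; rewrite mem_job_ids => /= jx.
apply: job_times_admissible jx; first by rewrite expn_gt0.
- exact: vnum_gt0.
- by move=> c _; apply: cnum_lt.
Qed.

Theorem star_of_template :
  yes_instance (star_of (map times_of job_ids) : instance (StarExp 4)) <->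
  exists alpha, template_sat tl w N alpha.
Proof.
apply: iff_trans (star_of_explorable job_ids_uniq job_ids_admissible) _.
apply: (@iff_trans _ (exists g : (nat * nat) * sid K -> nat * nat,
     (forall x, is_job_at x -> interval_of (times_of x) (g x)) /\
     (forall x y, is_job_at x -> is_job_at y -> x != y ->
        disjoint_intervals (g x) (g y)))).
  by split=> -[g [gP gD]]; exists g;
    split=> [x jx|x y jx jy]; [apply: gP|apply: gD|apply: gP|apply: gD];
    rewrite ?mem_job_ids // -mem_job_ids.
have sch := @schedule_satisfiable _ K code_bound (in_range N) var_ok clause_active
  clause_var vnum cnum.
apply: iff_trans (sch _ vnum_gt0 in_range_ok clause_var_ok vnum_inj
  (fun c _ => cnum_lt c) cnum_inj) _; first by rewrite expn_gt0.
split=> -[alpha sat]; exists alpha.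
  move=> t j lt_t lt_j; apply/(all_nthP d0) => c lt_c; apply/implyP => act.
  have [|p lt_p] := sat ((t, j), c).
    by rewrite /clause_active /in_range /= lt_t lt_j lt_c.
  rewrite /clause_var -/(lit_holds _ _ _ _ _) /gc /=.
  by case: p lt_p => [|[|[|p]]] //= _; rewrite /lit_holds => ->; rewrite ?orbT.
move=> [[t j] c] /and3P[/andP[/= lt_t lt_j] lt_c act].
have /implyP/(_ act) := all_nthP d0 (sat t j lt_t lt_j) c lt_c.
by case/or3P => H; [exists 0 | exists 1 | exists 2].
Qed.

(** [job_ids] enumerates the leaves in the order of the double loop and filters them by the guards,
    so the encoding is literally the output of the template. *)
Lemma encode_star_template :
  encode_star (star_of (map times_of job_ids)) =
  template_out job_list job_guard job_pieces w N.
Proof.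
rewrite encode_star_of ?all_map ?job_ids_admissible // -map_comp.
have -> : map (encode_job \o times_of) job_ids =
    [seq encode_bits_job (map (time_bits N x.1.1 x.1.2) (job_pieces x.2)) | x <- job_ids].
  apply/eq_in_map => -[[t j] s]; rewrite mem_job_ids => jx /=.
  have /andP[lt_t lt_j] : (t < N) && (j < N).
    by case: (s) jx => [k|k b|c|c|c p] //=; rewrite /is_job_at /is_job /clause_active /=; do ?[by case/and3P | case/andP].
  rewrite -(job_pieces_times lt_t lt_j jx) encode_job_bval //.
  exact: job_pieces_last.
have flat X Y (f : X -> seq Y) (ss : seq (seq X)) :
    flatten (map f (flatten ss)) = flatten [seq flatten (map f s) | s <- ss].
  by elim: ss => //= s ss IH; rewrite map_cat flatten_cat IH.
rewrite /job_ids filter_flatten flat -!map_comp flat -!map_comp.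
congr flatten; apply: eq_map => t /=; rewrite -!map_comp.
congr flatten; apply: eq_map => j /=.
by elim: job_list => //= s l IH; case: ifP => _ /=; rewrite -IH.
Qed.

End Indices.
End Concrete.

(** * Runs of a nondeterministic machine as satisfying assignments *)

(* Cells are numbered from the head, to the left and (starting with the scanned
   cell) to the right, so that a step moves the contents and not the head. *)
Definition cell_at (A : finType) (x : tape A) (r : bool) (j : nat) : symbol A :=
  nth None (if r then scanned x :: right_of x else left_of x) j.

Definition written (m : move) : bool * nat :=
  match m with MoveLeft => (true, 1) | Stay => (true, 0) | MoveRight => (false, 0) end.

(** Each entry pairs the address of a cell before the move with its address after it. The targets
    are all addresses except the one given by [written]. *)
Definition shifts (m : move) : seq (bool * mode * (bool * mode)) :=
  match m with
  | MoveLeft => [:: (false, Const 0, (true, Const 0)); (false, Off 1, (false, Off 0));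
                    (true, Off 1, (true, Off 2))]
  | Stay => [:: (true, Off 1, (true, Off 1)); (false, Off 0, (false, Off 0))]
  | MoveRight => [:: (false, Off 0, (false, Off 1)); (true, Off 1, (true, Off 0))]
  end.

Definition shift_holds (A : finType) (x x' : tape A)
    (sh : bool * mode * (bool * mode)) (j : nat) : bool :=
  cell_at x' sh.2.1 (apply_mode sh.2.2 j) == cell_at x sh.1.1 (apply_mode sh.1.2 j).

Lemma cell_at_written (A : finType) (x : tape A) s m :
  cell_at (tape_act x (s, m)) (written m).1 (written m).2 = s.
Proof. by case: m. Qed.

Lemma cell_at_shift (A : finType) (x : tape A) s m j :
  all (fun sh => shift_holds x (tape_act x (s, m)) sh j) (shifts m).
Proof.
case: x => l c r; case: m; rewrite /shift_holds /cell_at /= ?add0n ?add1n ?add2n /=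
  ?nth_behead ?eqxx ?nth0 //= ?andbT.
by case: r => //=; case: j => //= j; rewrite nth_nil.
Qed.

(** The bound [n.+1] on the old address means that the known part of a tape shrinks by at most one
    cell per step. *)
Lemma cell_at_origin m r n : (r, n) = written m \/
  exists2 j, j <= n & has (fun sh => [&& sh.2.1 == r, apply_mode sh.2.2 j == n
    & apply_mode sh.1.2 j <= n.+1]) (shifts m).
Proof.
case: m r n => [] [] [|[|n]]; try (by left); right.
all: first [by exists 0 | by exists 1 | by exists n; rewrite /= ?eqxx ?orbT //; lia
           | by exists n.+1; rewrite /= ?eqxx ?orbT //; lia
           | by exists n.+2; rewrite /= ?eqxx ?orbT //; lia].
Qed.

Section CookLevin.

Variable M : machine.

Let tape_ix := 'I_(extra_tapes M).+1.
Let A := symbol (aux_symbol M).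
Let Q := state M.

Definition transition : finType :=
  (Q * {ffun tape_ix -> A} * (Q * {ffun tape_ix -> A * move}))%type.
Definition kind : finType :=
  (transition + 'I_(#|transition|.+1) + Q + (bool * tape_ix * A))%type.

Definition KAct (a : transition) : kind := inl (inl (inl a)).
Definition KAux (x : 'I_(#|transition|.+1)) : kind := inl (inl (inr x)).
Definition KState (q : Q) : kind := inl (inr q).
Definition KCell (r : bool) (i : tape_ix) (s : A) : kind := inr (r, i, s).

(* An accepting halting configuration is repeated forever. *)
Definition legal (a : transition) : bool :=
  (a.2 \in delta a.1.1 a.1.2) ||
  [&& delta a.1.1 a.1.2 == set0, accepting a.1.1
    & a.2 == (a.1.1, [ffun i => (a.1.2 i, Stay)])].

Definition lit (s : bool) (dt : nat) (mj : mode) (k : kind) : tlit kind :=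
  TLit s (Off dt) mj k.
(** Transitions and states have no cell index and are placed at [j = 0]; clauses that only mention
    such fixed positions are repeated for every [j]. *)
Definition not_act (a : transition) : tlit kind := lit false 0 (Const 0) (KAct a).
Definition clause1 (l : tlit kind) : option (option bool) * clause kind :=
  (None, (l, l, l)).
Definition clause2 (l l' : tlit kind) : option (option bool) * clause kind :=
  (None, (l, l', l')).
Definition clause3 (l l' l'' : tlit kind) : option (option bool) * clause kind :=
  (None, (l, l', l'')).
Definition initial (x : option bool) (mj : mode) (k : kind) :
    option (option bool) * clause kind :=
  let l := TLit true (Const 0) mj k in (Some x, (l, l, l)).

Definition input_symbol (x : option bool) : A := if x is Some b then Some (inl b) else None.

(* The auxiliary variable number [x] says that the transition chosen is one of
   those with rank at least [x]. *)
Definition act_template : template kind :=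
  [seq clause1 (not_act a) | a <- enum transition & ~~ legal a] ++
  [:: clause1 (lit true 0 (Const 0) (KAux ord0));
      clause1 (lit false 0 (Const 0) (KAux ord_max))] ++
  [seq clause3 (lit false 0 (Const 0) (KAux (inord (enum_rank a))))
     (lit true 0 (Const 0) (KAct a))
     (lit true 0 (Const 0) (KAux (inord (enum_rank a).+1))) | a <- enum transition].

Definition read_template : template kind :=
  [seq clause2 (lit false 0 (Const 0) (KState p.2)) (not_act p.1)
     | p : transition * Q <- enum {: transition * Q} & p.2 != p.1.1.1] ++
  [seq clause2 (lit false 0 (Const 0) (KCell true p.1.2 p.2)) (not_act p.1.1)
     | p : transition * tape_ix * A <- enum {: transition * tape_ix * A} & p.2 != p.1.1.1.2 p.1.2].

Definition write_template : template kind :=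
  [seq clause2 (not_act a) (lit true 1 (Const 0) (KState a.2.1)) | a <- enum transition] ++
  [seq (let w := written (p.1.2.2 p.2).2 in
        clause2 (not_act p.1) (lit true 1 (Const w.2) (KCell w.1 p.2 (p.1.2.2 p.2).1)))
     | p : transition * tape_ix <- enum {: transition * tape_ix}].

Definition shift_template : template kind :=
  flatten [seq [seq clause3 (not_act p.1.1) (lit false 0 sh.1.2 (KCell sh.1.1 p.1.2 p.2))
                      (lit true 1 sh.2.2 (KCell sh.2.1 p.1.2 p.2))
                  | sh <- shifts (p.1.1.2.2 p.1.2).2]
     | p : transition * tape_ix * A <- enum {: transition * tape_ix * A}].

Definition initial_template : template kind :=
  flatten [seq initial x (Const 0) (KState (start M)) ::
     [seq initial x (Off 0) (KCell false i None) | i <- enum tape_ix] ++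
     [seq initial x (Off 0) (KCell true i (if i == ord0 then input_symbol x else None))
        | i <- enum tape_ix]
   | x <- enum {: option bool}].

Definition machine_template : template kind :=
  act_template ++ read_template ++ write_template ++ shift_template ++ initial_template.

(** With [P] arbitrary, one analysis of the template serves for its well-formedness, for its
    satisfaction by a run, and for the use of a given assignment. *)
Record template_spec (P : pred (option (option bool) * clause kind)) : Prop := {
  spec_illegal : forall a, ~~ legal a -> P (clause1 (not_act a));
  spec_first : P (clause1 (lit true 0 (Const 0) (KAux ord0)));
  spec_last : P (clause1 (lit false 0 (Const 0) (KAux ord_max)));
  spec_chain : forall a, P (clause3 (lit false 0 (Const 0) (KAux (inord (enum_rank a))))
    (lit true 0 (Const 0) (KAct a)) (lit true 0 (Const 0) (KAux (inord (enum_rank a).+1))));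
  spec_state : forall (a : transition) q, q != a.1.1 ->
    P (clause2 (lit false 0 (Const 0) (KState q)) (not_act a));
  spec_read : forall (a : transition) i s, s != a.1.2 i ->
    P (clause2 (lit false 0 (Const 0) (KCell true i s)) (not_act a));
  spec_next : forall (a : transition), P (clause2 (not_act a) (lit true 1 (Const 0) (KState a.2.1)));
  spec_write : forall (a : transition) i, let w := written (a.2.2 i).2 in
    P (clause2 (not_act a) (lit true 1 (Const w.2) (KCell w.1 i (a.2.2 i).1)));
  spec_shift : forall (a : transition) i s, all (fun sh =>
    P (clause3 (not_act a) (lit false 0 sh.1.2 (KCell sh.1.1 i s))
         (lit true 1 sh.2.2 (KCell sh.2.1 i s)))) (shifts (a.2.2 i).2);
  spec_start : forall x, P (initial x (Const 0) (KState (start M)));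
  spec_left : forall x i, P (initial x (Off 0) (KCell false i None));
  spec_right : forall x i, P (initial x (Off 0)
    (KCell true i (if i == ord0 then input_symbol x else None)))
}.

Lemma machine_templateP P : all P machine_template <-> template_spec P.
Proof.
have allI X Y (f : X -> Y) (p : pred Y) xs : all p (map f xs) = all (fun x => p (f x)) xs.
  exact: all_map.
have E (T : finType) (f : T -> option (option bool) * clause kind) :
    all P [seq f x | x <- enum T] <-> forall x, P (f x).
  by rewrite allI; split=> [/allP H x|H]; [apply: H; rewrite mem_enum | apply/allP].
have F (T : finType) (f : T -> option (option bool) * clause kind) (q : pred T) :
    all P [seq f x | x <- enum T & q x] <-> forall x, q x -> P (f x).
  rewrite allI all_filter; split=> [/allP H x|H].
    by move=> qx; apply: (implyP (H x _)); rewrite ?mem_enum.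
  by apply/allP => x _; apply/implyP; apply: H.
have E' (T : finType) (f : T -> template kind) :
    all P (flatten [seq f x | x <- enum T]) <-> forall x, all P (f x).
  have -> xs : all P (flatten (map f xs)) = all (fun x => all P (f x)) xs.
    by elim: xs => //= x xs IH; rewrite all_cat IH.
  by split=> [/allP H x|H]; [apply: H; rewrite mem_enum | apply/allP].
rewrite /machine_template /act_template /read_template /write_template
  /shift_template /initial_template !all_cat.
split.
  case/and5P=> /and3P[/F h1 /and3P[h2 h3 _] /E h4] /andP[/F h5 /F h6] /andP[/E h7 /E h8]
    /E' h9 /E' h10.
  split=> //.
  - by move=> a q; apply: (h5 (a, q)).
  - by move=> a i s; apply: (h6 (a, i, s)).
  - by move=> a i; apply: (h8 (a, i)).
  - by move=> a i s; have := h9 (a, i, s); rewrite allI.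
  - by move=> x; have /andP[] := h10 x.
  - by move=> x i; have := h10 x; rewrite -cat1s !all_cat => /and3P[_ /E H _]; apply: H.
  - by move=> x i; have := h10 x; rewrite -cat1s !all_cat => /and3P[_ _ /E H]; apply: H.
case=> h1 h2 h3 h4 h5 h6 h7 h8 h9 h10 h11 h12.
apply/and5P; split.
- by apply/and3P; split; [apply/F | rewrite /= h2 h3 | apply/E].
- by apply/andP; split; apply/F => -[a q]; [apply: h5 | case: a => a i; apply: h6].
- by apply/andP; split; apply/E => // -[a i]; apply: h8.
- by apply/E' => -[[a i] s]; rewrite allI; apply: h9.
apply/E' => x; rewrite -cat1s !all_cat; apply/and3P; split.
- by rewrite /= h10.
- by apply/E => i; apply: h11.
- by apply/E => i; apply: h12.
Qed.

Lemma machine_template_ok : all (fun gc => clause_ok gc.2) machine_template.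
Proof.
apply/machine_templateP; split=> //.
  by move=> a i; case: (a.2.2 i) => s' [].
by move=> a i s; case: (a.2.2 i) => s' [].
Qed.

(** * Accepting runs and satisfying assignments *)

Section Formula.

Variables (w : seq bool) (N : nat).

(** The run is infinite, a halting accepting configuration being repeated, so that it gives values
    to the variables at every time, whatever [N] is. *)
Definition run_of (cf : nat -> config M) (ac : nat -> transition) : Prop :=
  cf 0 = init M w /\ forall t,
    [/\ legal (ac t), (ac t).1.1 = current (cf t),
        (ac t).1.2 = [ffun i => scanned (tapes (cf t) i)]
      & cf t.+1 = Config (ac t).2.1 [ffun i => tape_act (tapes (cf t) i) ((ac t).2.2 i)]].

Lemma accepting_run : (exists n (c : config M),
    [/\ steps n (init M w) c, halted c & accepting (current c)]) ->
  exists cf ac, run_of cf ac.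
Proof.
case=> n [c [st halt acc]]; rewrite /run_of; elim: st halt acc => {n c}; last first.
  move=> n c c' c'' [a aP Ec'] _ IH halt acc; have [cf [ac [cf0 runP]]] := IH halt acc.
  pose a' : transition := (current c, [ffun i => scanned (tapes c i)], a).
  exists (fun t => if t is t'.+1 then cf t' else c), (fun t => if t is t'.+1 then ac t' else a').
  split=> // -[|t] //=; split=> //; last by rewrite cf0 Ec'.
  by rewrite /legal aP.
move=> c halt acc; exists (fun=> c).
exists (fun=> (current c, [ffun i => scanned (tapes c i)],
               (current c, [ffun i => (scanned (tapes c i), Stay)]))).
split=> // _; split=> //=.
  rewrite /legal /= acc; apply/orP; right; apply/and3P; split=> //.
    exact/eqP.
  by apply/eqP; congr pair; apply/ffunP => i; rewrite !ffunE.
case: c {halt acc} => q T; congr Config; apply/ffunP => i; rewrite !ffunE /=.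
by case: (T i).
Qed.

Definition run_assignment (cf : nat -> config M) (ac : nat -> transition)
    (v : (nat * nat) * kind) : bool :=
  let: ((t, j), k) := v in
  match k with
  | inl (inl (inl a)) => ac t == a
  | inl (inl (inr x)) => x <= enum_rank (ac t)
  | inl (inr q) => current (cf t) == q
  | inr (r, i, s) => cell_at (tapes (cf t) i) r j == s
  end.

Lemma run_satisfies cf ac : run_of cf ac ->
  template_sat machine_template w N (run_assignment cf ac).
Proof.
case=> cf0 runP t j lt_t lt_j; have [leg Eq Es Ecf] := runP t.
set H := fun gc => _.
have holds l : run_assignment cf ac (lit_var t j l) == lsign l ->
    lit_holds N (run_assignment cf ac) t j l by rewrite /lit_holds => ->; rewrite orbT.
have H1 l : run_assignment cf ac (lit_var t j l) == lsign l -> H (clause1 l).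
  by move=> /holds E; rewrite /H /= E.
have H2 l l' : (run_assignment cf ac (lit_var t j l) == lsign l) ||
    (run_assignment cf ac (lit_var t j l') == lsign l') -> H (clause2 l l').
  by case/orP => /holds E; rewrite /H /= E ?orbT.
have H3 l l' l'' : [|| run_assignment cf ac (lit_var t j l) == lsign l,
    run_assignment cf ac (lit_var t j l') == lsign l' |
    run_assignment cf ac (lit_var t j l'') == lsign l''] -> H (clause3 l l' l'').
  by case/or3P => /holds E; rewrite /H /= E ?orbT.
have act a : ac t == a \/ run_assignment cf ac (lit_var t j (not_act a)) == false.
  by rewrite /= add0n; case: (ac t == a); [left | right].
have init_x x mj k : (nth None (map Some w) j == x -> t = 0 ->
    run_assignment cf ac ((0, apply_mode mj j), k)) -> H (initial x mj k).
  move=> E; rewrite /H /=; apply/implyP => /andP[/eqP t0 xP].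
  by rewrite holds //; apply/eqP; apply: E.
apply/machine_templateP; split.
- move=> a nleg; apply: H1 => /=.
  by rewrite add0n eqbF_neg; apply: contra nleg => /eqP <-.
- by apply: H1.
- by apply: H1 => /=; rewrite add0n eqbF_neg -ltnNge ltn_ord.
- move=> a; apply: H3 => /=; rewrite add0n !inordK; try by rewrite ltnS // ltnW.
  rewrite !eqbF_neg !eqb_id -ltnNge; case: (ltngtP (enum_rank a) (enum_rank (ac t))) => //=.
    by rewrite orbT.
  by move=> /val_inj/enum_rank_inj ->; rewrite eqxx.
- move=> a q ne; apply: H2 => /=.
  case: (act a) => [/eqP E|->]; last by rewrite orbT.
  by rewrite add0n -Eq E (eq_sym a.1.1) (negbTE ne).
- move=> a i s ne; apply: H2 => /=.
  case: (act a) => [/eqP E|->]; last by rewrite orbT.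
  by move: ne; rewrite -E Es ffunE /cell_at /= add0n eq_sym => /negbTE ->.
- move=> a; apply: H2; case: (act a) => [/eqP E|->] //.
  by rewrite /= add1n Ecf -E /= eqxx orbT.
- move=> a i; apply: H2; case: (act a) => [/eqP E|->] //.
  rewrite /= add1n Ecf -E /= ffunE; case: ((ac t).2.2 i) => s m.
  by rewrite cell_at_written /= eqxx orbT.
- move=> a i s; case: (act a) => [/eqP E|na]; last first.
    by elim: (shifts _) => //= sh shs ->; rewrite H3 // na.
  rewrite -E; apply: sub_all (cell_at_shift (tapes (cf t) i) ((ac t).2.2 i).1 _ j) => sh.
  move=> /eqP E'; apply: H3; rewrite /= add1n add0n Ecf /= ffunE.
  rewrite [(ac t).2.2 i]surjective_pairing E'.
  by case: (cell_at _ _ _ == _); rewrite ?orbT.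
- by move=> x; apply: init_x; rewrite /= cf0.
- move=> x i; apply: init_x => _ _; rewrite /= cf0 /= ffunE.
  by case: (i == ord0); rewrite /cell_at /= ?nth_nil.
- move=> x i; apply: init_x => /eqP <- _; rewrite /= cf0 /= ffunE /cell_at add0n.
  case: (i == ord0) => /=; last by case: (j) => //= j'; rewrite nth_nil.
  have -> : head None [seq Some (inl b) | b <- w] :: behead [seq Some (inl b) | b <- w]
      = if w is [::] then [:: None] else [seq Some (inl b) | b <- w] by case: (w).
  case: (w) => [|b v]; first by case: (j) => //= j'; rewrite nth_nil.
  case: (ltnP j (size (b :: v))) => [lt_jv|le_vj].
    by rewrite !(nth_map false).
  by rewrite !nth_default ?size_map.
Qed.

Lemma steps_rcons n (c c' c'' : config M) :
  steps n c c' -> step c' c'' -> steps n.+1 c c''.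
Proof.
elim=> {n c c'} [c st|n c d c' st _ IH st']; first exact: stepsS st (steps0 _).
exact: stepsS st (IH st').
Qed.

Lemma all_has X (p q r : pred X) s : all p s -> all q s -> has r s ->
  exists x, [&& p x, q x & r x].
Proof.
elim: s => //= x s IH /andP[px ps] /andP[qx qs] /orP[rx|rs]; last exact: IH.
by exists x; rewrite px qx.
Qed.

Definition accepted : Prop := exists n (c : config M),
  [/\ steps n (init M w) c, halted c & accepting (current c)].

Variable alpha : (nat * nat) * kind -> bool.
Hypothesis sat : template_sat machine_template w N alpha.

(** Only the truth of the variables that describe [c] is recorded. The window [n + t < N] loses a
    cell per step, since a move may bring in a cell from beyond its border. *)
Definition follows (t : nat) (c : config M) : Prop :=
  [/\ steps t (init M w) c, alpha ((t, 0), KState (current c)) &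
      forall r i n, n + t < N -> alpha ((t, n), KCell r i (cell_at (tapes c i) r n))].

Lemma spec_at t j : t < N -> j < N -> template_spec (fun gc => active w t j gc.1 ==>
    [|| lit_holds N alpha t j gc.2.1.1, lit_holds N alpha t j gc.2.1.2
      | lit_holds N alpha t j gc.2.2]).
Proof. by move=> lt_t lt_j; apply/machine_templateP; apply: sat. Qed.

Lemma follows_init : 0 < N -> follows 0 (init M w).
Proof.
move=> N0; split; first exact: steps0.
  have := spec_start (spec_at N0 N0) (nth None (map Some w) 0).
  by rewrite /= eqxx /lit_holds /in_range /= N0 /= !orbb => /eqP.
move=> r i n; rewrite addn0 => lt_n.
pose x := nth None (map Some w) n.
have -> : cell_at (tapes (init M w) i) r n =
    if r then if i == ord0 then input_symbol x else None else None.
  rewrite /= ffunE /cell_at /x; case: r => /=; last first.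
    by case: (i == ord0); rewrite nth_nil.
  case: (i == ord0) => /=; last by case: (n) => //= n'; rewrite nth_nil.
  case: (w) => [|b v]; first by case: (n) => //= n'; rewrite !nth_nil.
  have -> : head None [seq Some (inl b) | b <- b :: v] :: behead [seq Some (inl b) | b <- b :: v]
      = [seq Some (inl b) | b <- b :: v] by [].
  case: (ltnP n (size (b :: v))) => [lt_nv|le_vn].
    by rewrite !(nth_map false).
  by rewrite !nth_default ?size_map.
have := spec_left (spec_at N0 lt_n) x i; have := spec_right (spec_at N0 lt_n) x i.
rewrite /= eqxx /lit_holds /in_range /= N0 !add0n lt_n /= !orbb => /eqP h1 /eqP h2.
by case: r.
Qed.

Lemma follows_transition t c : t < N -> follows t c ->
  exists a, [/\ alpha ((t, 0), KAct a), legal a, a.1.1 = current c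
    & a.1.2 = [ffun i => scanned (tapes c i)]].
Proof.
move=> lt_t [_ stP cellP]; have N0 : 0 < N by apply: leq_ltn_trans lt_t.
have S := spec_at lt_t N0.
have inr k : in_range N ((t, 0), k : kind) by rewrite /in_range /= lt_t.
have holdsE s k : lit_holds N alpha t 0 (lit s 0 (Const 0) k) = (alpha ((t, 0), k) == s).
  by rewrite /lit_holds [lit_var _ _ _]/lit_var /= add0n inr.
have [a aP] : exists a, alpha ((t, 0), KAct a).
  case: (boolP [exists a, alpha ((t, 0), KAct a)]) => [/existsP //|/existsPn none].
  (* If no transition were true, the chain would carry the truth of [KAux] from rank 0 up to
     [ord_max], where it is forbidden. The chain replaces a long disjunction, as clauses have three
     literals. *)
  have aux x : x <= #|transition| -> alpha ((t, 0), KAux (inord x)).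
    elim: x => [|x IH] lt_x.
      have := spec_first S; rewrite /= !holdsE !orbb => /eqP.
      by congr (alpha (_, KAux _)); apply: val_inj; rewrite /= inordK.
    have := spec_chain S (enum_val (Ordinal lt_x)).
    rewrite /= !holdsE enum_valK /= IH; last exact: ltnW.
    by rewrite (negbTE (none _)) /= => /eqP.
  have := spec_last S; rewrite /= !holdsE !orbb.
  have -> : ord_max = inord #|transition| :> 'I_(#|transition|.+1).
    by apply: val_inj; rewrite /= inordK.
  by rewrite aux.
exists a; split=> //.
- apply: contraT => nleg; have := spec_illegal S nleg.
  by rewrite /= !holdsE aP.
- apply/eqP; apply: contraT; rewrite eq_sym => ne; have := spec_state S ne.
  by rewrite /= !holdsE aP stP.
apply/ffunP => i; rewrite ffunE; apply/eqP; apply: contraT; rewrite eq_sym => ne.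
have := spec_read S ne; rewrite /= !holdsE aP.
by have := cellP true i 0 lt_t; rewrite /cell_at /= => ->.
Qed.

Lemma follows_step t c : t.+1 < N -> follows t c ->
  accepted \/ exists c', follows t.+1 c'.
Proof.
move=> lt_t1 fol; have lt_t : t < N by apply: ltnW.
have N0 : 0 < N by apply: leq_ltn_trans lt_t.
have [a [aP leg Eq Es]] := follows_transition lt_t fol; have [st _ cellP] := fol.
have S := spec_at lt_t N0.
case/orP: leg => [inD|/and3P[/eqP halt acc _]]; last first.
  left; exists t, c; split=> //; last by rewrite -Eq.
  by rewrite /halted /options -Eq -Es.
right; exists (Config a.2.1 [ffun i => tape_act (tapes c i) (a.2.2 i)]).
have notE j : lit_holds N alpha t j (not_act a) = false.
  by rewrite /lit_holds /lit_var /in_range /= !add0n lt_t N0 aP.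
split.
- by apply: steps_rcons st _; exists a.2 => //; rewrite /options -Eq -Es.
- have := spec_next S a; rewrite /= notE /lit_holds /lit_var /in_range /= add1n lt_t1 N0 /=.
  by rewrite orbb => /eqP.
move=> r i n lt_n; rewrite /= ffunE.
have lt_nN : n < N by apply: leq_ltn_trans lt_n; apply: leq_addr.
case: (cell_at_origin (a.2.2 i).2 r n) => [E|[j le_j]].
  have := spec_write S a i; rewrite -E /= notE /lit_holds /lit_var /in_range /= add1n lt_t1 lt_nN /=.
  rewrite orbb => /eqP; rewrite [a.2.2 i]surjective_pairing.
  by have := cell_at_written (tapes c i) (a.2.2 i).1 (a.2.2 i).2; rewrite -E /= => ->.
have lt_j : j < N by apply: leq_ltn_trans lt_nN.
set x' := tape_act _ _.
have sh1 : all (fun sh => shift_holds (tapes c i) x' sh j) (shifts (a.2.2 i).2).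
  by rewrite /x' [a.2.2 i]surjective_pairing; apply: cell_at_shift.
have sh2 := spec_shift (spec_at lt_t lt_j) a i (cell_at x' r n).
move=> /(all_has sh1 sh2)[[[r1 m1] [r2 m2]] /= /and3P[/eqP /= E sh]].
case/and3P=> /eqP Er /eqP En le_n1; move: sh; rewrite notE /lit_holds /lit_var /in_range /=.
rewrite add0n add1n lt_t lt_t1 En lt_nN /= -Er -En E cellP ?eqb_id; last by lia.
by have -> : apply_mode m1 j < N by lia.
Qed.

(** Short of acceptance, the assignment forces a run of [N.-1] steps, one more than the bound on all
    runs allows. *)
Lemma satisfying_accepts : (forall n c, steps n (init M w) c -> n.+2 <= N) ->
  accepted.
Proof.
move=> bound; have N0 : 0 < N by apply: ltnW; apply: (bound 0 (init M w)); apply: steps0.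
have H t : t < N -> accepted \/ exists c, follows t c.
  elim: t => [|t IH] lt_t; first by right; exists (init M w); apply: follows_init.
  case: (IH (ltnW lt_t)) => [|[c fol]]; first by left.
  exact: follows_step fol.
case: (H N.-1) => [|//|[c [st _ _]]]; first by rewrite ltn_predL.
by have := bound _ _ st; rewrite prednK // ltnn.
Qed.

End Formula.
End CookLevin.

(** * The reduction *)

Theorem theorem3p1 : NP_hard (StarExp 4).
Proof.
move=> L [M [a [d LM]]]; have [e eP] := grow_dominates a d.
pose tl := machine_template M.
(* A default value for [nth] in the list of clauses. *)
pose d0 : option (option bool) * clause (kind M) :=
  clause1 (lit true 0 (Const 0) (KState (start M))).
pose N (w : seq bool) := grow e (size w).+2.
exists (fun w => star_of (map (times_of tl d0 (N w)) (job_ids tl d0 w (N w)))).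
have N0 w : 0 < N w by apply: leq_trans (grow_ge _ _).
have ok := machine_template_ok M.
split=> [|w].
  have [m [det [b [k spec]]]] := template_computable (job_list tl) (job_guard tl d0) (job_pieces tl d0) e.
  exists m; split=> //; exists b, k => w; have [n [c [le_n st halt out]]] := spec w.
  by exists n, c; split=> //; rewrite out -(encode_star_template d0 w (N0 w) ok).
have [bound ->] := LM w.
apply: iff_sym; apply: iff_trans (star_of_template d0 w (N0 w) ok) _.
split=> [[alpha sat]|acc].
  apply: satisfying_accepts sat _ => n c /bound le_n.
  by apply: leq_trans (eP _); rewrite -addn2 leq_add2r.
have [cf [ac run]] := accepting_run acc.
by exists (run_assignment cf ac); apply: run_satisfies.
Qed.
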